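(* Let $G$ be a connected well-covered unicyclic graph of odd order $n$. Then: (i) if $n\le 7$, then $\xi(C_n)\le \xi(G)\le\xi(M_n)$; (ii) if $n\ge 9$ and $H_n\in\mathcal{S}_P$ has order $n$, then $\xi(H_n)\le \xi(G)\le\xi(M_n)$.
   Context: All graphs are finite, simple and undirected. A graph is well-covered if all of its maximal independent sets have the same size. A connected unicyclic graph is a connected graph containing exactly one cycle. The independence polynomial of a graph $G$ is $I(G,x)=\sum_{k\ge 0} i_kx^k$, where $i_k$ is the number of independent sets of size $k$ in $G$. It is known that the root of $I(G,x)$ of smallest modulus is real and lies in $[-1,0)$; it is denoted $\xi(G)$ (equivalently, the largest real root of $I(G,x)$). $C_n$ is the cycle and $P_n$ the path on $n$ vertices. For a graph $G$, the graph star $G^{\ast}$ is obtained from $G$ by attaching, for each vertex $v$ of $G$, a new vertex $v^{\ast}$ joined by an edge to $v$ only. For $m\ge 3$, $U_m$ is the graph on $m$ vertices obtained from a triangle by attaching $m-3$ pendant vertices (leaves) to one fixed vertex of the triangle. For odd $n\ge 3$, $M_n$ is the graph of order $n$ obtained from $U_{(n+3)/2}$ by subdividing each of its pendant edges once; that is, $M_n$ consists of a triangle with a distinguished vertex $c$ together with $\frac{n-3}{2}$ disjoint copies of $K_2$, with exactly one vertex of each copy joined by an edge to $c$. For $g\in\{3,5\}$ and integers $k,\ell\ge 0$ with $k>0$ or $\ell>0$, $G(g,k,\ell)$ is the graph obtained from a cycle with vertices $c_1,c_2,\dots,c_g$ in cyclic order as follows: if $k>0$, take a disjoint copy of $P_k^{\ast}$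 and join $c_1$ by an edge to an end vertex of the path $P_k$ (so for $k\ge2$ this unique neighbour of $c_1$ in $P_k^{\ast}$ has degree $3$); if $\ell>0$, take a disjoint copy of $P_\ell^{\ast}$ and join $c_3$ by an edge to an end vertex of the path $P_\ell$. $\mathcal{S}_P$ is the set of all graphs $G(g,k,\ell)$ for all such $g,k,\ell$. *)

(* Defs.v *)
From HB Require Import structures.
From mathcomp Require Import all_boot all_order all_algebra.
From mathcomp Require Import classical_sets reals.
From mathcomp Require Import complex.

Set Implicit Arguments.
Unset Strict Implicit.
Unset Printing Implicit Defensive.

Import Order.TTheory GRing.Theory Num.Theory.

(* Finite simple undirected graphs. *)
Record sgraph := SGraph {
  vertex :> finType;
  adj : rel vertex;
  adj_sym : symmetric adj;
  adj_irr : irreflexive adj }.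

Arguments adj {s} : rename.

(* The simple graph on V whose edges are the pairs of distinct vertices
   related by r in at least one direction; used to list each edge once. *)
Section GraphOf.
Variables (V : finType) (r : rel V).

Definition sym_rel : rel V := fun x y => (x != y) && (r x y || r y x).

Lemma sym_rel_sym : symmetric sym_rel.
Proof. by move=> x y; rewrite /sym_rel eq_sym orbC. Qed.

Lemma sym_rel_irr : irreflexive sym_rel.
Proof. by move=> x; rewrite /sym_rel eqxx. Qed.

Definition graph_of : sgraph := SGraph sym_rel_sym sym_rel_irr.
End GraphOf.

Definition graph_iso (G H : sgraph) : Prop :=
  exists2 f : G -> H, bijective f & forall x y, adj (f x) (f y) = adj x y.

Section GraphProperties.
Variable G : sgraph.

Definition independent (S : {set G}) : bool :=
  [forall x in S, forall y in S, ~~ adj x y].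

Definition well_covered : Prop :=
  forall S T : {set G},
    maxset independent S -> maxset independent T -> #|S| = #|T|.

Definition connected : Prop := 0 < #|G| /\ forall x y : G, connect adj x y.

(* A cyclic sequence of distinct, consecutively adjacent vertices, of length
   at least 3.  Different sequences may traverse the same cycle: as a
   subgraph, a cycle is determined by its set of edges. *)
Definition is_cycle (c : seq G) : bool := (2 < size c) && ucycleb adj c.

Definition cycle_edges (c : seq G) : {set {set G}} :=
  [set [set x; next c x] | x in c].

Definition unicyclic : Prop :=
  exists2 c, is_cycle c &
    forall c', is_cycle c' -> cycle_edges c' = cycle_edges c.

Definition nb_independent (k : nat) : nat :=
  #|[set S : {set G} | independent S && (#|S| == k)]|.

Local Open Scope ring_scope.

Definition indep_poly (K : nzRingType) : {poly K} :=
  \poly_(k < #|G|.+1) (nb_independent k)%:R.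

Local Open Scope classical_set_scope.
Local Open Scope complex_scope.

(* The real root of I(G, x) whose modulus is smallest among those of all the
   complex roots.  It is unique, as I(G, x) has no root that is >= 0; it
   exists unless G is empty, and the value 0 is a dummy for that case. *)
Definition xi (R : realType) : R :=
  xget 0 [set x : R | root (indep_poly R[i]) x%:C /\
    forall z : R[i], root (indep_poly R[i]) z -> `|x%:C| <= `|z|].

End GraphProperties.

Definition path_graph (n : nat) : sgraph :=
  graph_of (fun i j : 'I_n => j == i.+1 :> nat).

(* The n-cycle when n >= 3. *)
Definition cycle_graph (n : nat) : sgraph :=
  graph_of (fun i j : 'I_n => j == i.+1 %% n :> nat).

(* The graph star: inl v is the vertex v, and inr v its pendant vertex. *)
Definition star_rel (G : sgraph) : rel (G + G) := fun u v =>
  match u, v with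
  | inl x, inl y => adj x y
  | inl x, inr y => x == y
  | _, _ => false
  end.

Definition star (G : sgraph) : sgraph := graph_of (@star_rel G).

(* M_n, for odd n >= 3: the triangle is 'I_3 with distinguished vertex 0, and
   the j-th copy of K_2 has vertices (j, false), joined to 0, and (j, true). *)
Definition M_rel (k : nat) : rel ('I_3 + 'I_k * bool) := fun u v =>
  match u, v with
  | inl _, inl _ => true
  | inl i, inr (_, b) => (i == 0 :> nat) && ~~ b
  | inr (j, b), inr (j', b') => (j == j') && (b != b')
  | _, _ => false
  end.

Definition M (n : nat) : sgraph := graph_of (@M_rel ((n - 3) %/ 2)).

(* G(g, k, l).  The vertex c_i of the g-cycle is i - 1 : 'I_g.  The end vertex
   0 of P_k is joined to c_1 and that of P_l to c_3; P_0 is empty and then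
   contributes neither vertices nor edges. *)
Definition Ggkl_rel (g k l : nat) :
    rel (cycle_graph g + (star (path_graph k) + star (path_graph l))) :=
  fun u v =>
  match u, v with
  | inl i, inl j => adj i j
  | inl i, inr (inl (inl a)) => (i == 0 :> nat) && (a == 0 :> nat)
  | inl i, inr (inr (inl b)) => (i == 2 :> nat) && (b == 0 :> nat)
  | inr (inl x), inr (inl y) => adj x y
  | inr (inr x), inr (inr y) => adj x y
  | _, _ => false
  end.

Definition Ggkl (g k l : nat) : sgraph := graph_of (@Ggkl_rel g k l).

(* Graphs are taken up to isomorphism. *)
Definition in_SP (H : sgraph) : Prop :=
  exists g k l : nat,
    [/\ g = 3 \/ g = 5, 0 < k \/ 0 < l & graph_iso H (Ggkl g k l)].

(* Main.v *)
(* Every cycle of G is the same one, C.  Well-coveredness, used as the exchange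
   property |X| <= |Y| whenever N[X] is contained in N[Y], lets one peel off
   pendant paths u - v until only C is left; parity forces |C| to be 3, 5 or 7,
   with nothing attached to a 7-cycle, at most two attached vertices on a
   triangle and no two adjacent ones on a pentagon.  Summing over the leaves (and the
   cycle vertices of degree 2) then gives, unless G = C_7,
     I(G, x) = (1 + x)^N I(K, x / (1 + x)),   |G| = 2 N + 1,
   for a tree K on N + 1 vertices: a star for M_n, a path for the members of
   S_P.  As y = t / (1 - t) increases with t, the claim reduces to comparing the first zeros
   of the I(K, -y) with those of the star and of the path.  These bounds are
   proved for the ratio I(K, -y) / I(K - v, -y) at a root v, by joining rooted
   trees along an edge. *)
Require Import Defs.
From mathcomp Require Import all_boot all_order all_algebra.
From mathcomp Require Import reals.
From mathcomp Require Import complex polyrcf.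
From mathcomp Require Import zify ring lra.

Set Implicit Arguments.
Unset Strict Implicit.
Unset Printing Implicit Defensive.

Import Order.TTheory GRing.Theory Num.Theory.

(** * Evaluation of independence polynomials *)

(** No root is computed. For 0 <= t < -xi(B) the values I(S, -t) are positive for every set S of
    vertices of B, not only for the full one. This stronger positivity excludes complex roots of
    smaller modulus and feeds the inductions on trees; xi(A) <= xi(B) follows as soon as it implies
    I(A, -t) > 0. Well-coveredness passes to S minus a closed neighbourhood, not to arbitrary
    subsets. Hence each peeling step removes a leaf with its neighbour, which is the closed
    neighbourhood of the leaf; two vertices go at a time, and this is why the parity of the order
    survives and decides. The weight x / (1 + x) arises because a leaf contributes 1 + x when its
    neighbour is not chosen and 1 when it is, so after extracting 1 + x each chosen neighbour
    carries x / (1 + x). C_7 does not factor in this way and is compared by hand. What matters there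
    is 4 t < 1: in t, the value of the path on four vertices is (1 - 2 t)(1 - 4 t) / (1 - t)^2. *)

Section ClosedNeighbourhood.
Variable G : sgraph.
Implicit Types (v x y : G) (S T A B : {set G}).

Definition cnbh v : {set G} := [set w | (w == v) || adj v w].

Lemma indepP S : reflect {in S &, forall x y, ~~ adj x y} (independent S).
Proof.
apply: (iffP forall_inP) => h x.
  by move=> y xS yS; have /forall_inP/(_ _ yS) := h x xS.
by move=> xS; apply/forall_inP => y yS; apply: h.
Qed.

Lemma indep0 : independent (set0 : {set G}).
Proof. by apply/indepP => x y; rewrite inE. Qed.

Lemma indepS A B : A \subset B -> independent B -> independent A.
Proof.
by move=> /subsetP AB /indepP iB; apply/indepP => x y /AB xB /AB; apply: iB.
Qed.

Lemma indepU1 v T :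
  independent (v |: T) = independent T && [forall x in T, ~~ adj v x].
Proof.
apply/idP/andP => [iv|[/indepP iT /forall_inP vT]].
  split; first exact: indepS (subsetUr _ _) iv.
  apply/forall_inP => x xT; move/indepP: iv; apply; rewrite !inE ?eqxx //.
  by rewrite xT orbT.
apply/indepP => x y; rewrite !inE => /orP[/eqP->|xT] /orP[/eqP->|yT].
- by rewrite adj_irr.
- exact: vT.
- by rewrite adj_sym vT.
- exact: iT.
Qed.

End ClosedNeighbourhood.

Lemma independent1 (G : sgraph) (v : G) : independent [set v].
Proof. by apply/indepP => x y; rewrite !inE => /eqP-> /eqP->; rewrite adj_irr. Qed.

Section Eval.
Local Open Scope ring_scope.
Variables (K : comNzRingType) (G : sgraph).
Implicit Types (x : K) (S T : {set G}).

(** The induced subgraph enters as a set S, so that deleting vertices never changes the graph. Since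
    [K] may be a polynomial ring, the same sum also serves as a polynomial. *)
Definition ieval S x : K :=
  \sum_(T : {set G} | (T \subset S) && independent T) x ^+ #|T|.

Lemma ieval0 x : ieval set0 x = 1.
Proof.
rewrite /ieval (bigD1 set0) ?sub0set ?indep0 //= cards0 expr0 big1 ?addr0 // => T.
by rewrite subset0 => /andP[/andP[-> _] ].
Qed.

Lemma ieval_rec S v x : v \in S ->
  ieval S x = ieval (S :\ v) x + x * ieval (S :\: cnbh v) x.
Proof.
move=> vS; rewrite /ieval (bigID (fun T : {set G} => v \in T)) /= addrC; congr (_ + _).
  by apply: eq_bigl => T; rewrite subsetD1; do !case: (_ \in _); rewrite ?andbT ?andbF.
rewrite big_distrr /= (reindex_onto (fun T : {set G} => v |: T) (fun T : {set G} => T :\ v)) /=; last first.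
  by move=> T /andP[_ vT]; rewrite setD1K.
apply: eq_big => [T|T].
  rewrite setU11 andbT indepU1; apply/idP/idP.
    case/andP=> /andP[vTS /andP[iT vT]] /eqP eT.
    have vnT : v \notin T by rewrite -eT !inE eqxx.
    rewrite iT andbT; apply/subsetP => y yT; rewrite !inE negb_or.
    rewrite (forall_inP vT) // andbT (subsetP vTS) ?inE ?yT ?orbT // andbT.
    by apply: contraNneq vnT => <-.
  case/andP=> /subsetP TS iT; rewrite iT /=.
  have vnT : v \notin T by apply/negP => /TS; rewrite !inE eqxx.
  rewrite setU1K // eqxx andbT subUset sub1set vS /=; apply/andP; split.
    by apply/subsetP => y /TS; rewrite !inE => /andP[].
  by apply/forall_inP => y /TS; rewrite !inE negb_or => /andP[/andP[]].
case/andP=> _ /eqP eT; rewrite cardsU1 -{1}eT !inE eqxx /= add1n exprS //.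
Qed.

Lemma ieval_indep S x : independent S -> ieval S x = (1 + x) ^+ #|S|.
Proof.
have [n] := ubnP #|S|; elim: n S => // n IH S leS iS.
case: (set_0Vmem S) => [->|[v vS]]; first by rewrite ieval0 cards0.
have e : S :\: cnbh v = S :\ v.
  apply/setP => y; rewrite !inE negb_or; case yS: (y \in S); last by rewrite !andbF.
  by rewrite (indepP _ iS) ?andbT.
move: leS; rewrite (cardsD1 v) vS ltnS add1n => leS.
rewrite (ieval_rec _ vS) e IH ?(indepS (subsetDl _ _) iS) //.
by rewrite exprS; ring.
Qed.

Lemma ieval_set1 (v : G) x : ieval [set v] x = 1 + x.
Proof. by rewrite ieval_indep ?cards1 ?independent1. Qed.

End Eval.

(** * The root of smallest modulus *)

Section Ratio.
Local Open Scope ring_scope.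
Variables (K : numFieldType) (G : sgraph).
Implicit Types (z t : K) (S A B : {set G}).

(* By the recurrence at v, |I(B, z)| >= |I(B - v, z)| - t |I(B - N[v], z)|, and the
   induction hypothesis bounds |I(B - N[v], z)| by a multiple of |I(B - v, z)|. *)
Lemma ieval_ratio_homo S z t : `|z| <= t ->
    (forall A, A \subset S -> 0 < ieval A (- t)) ->
  forall A B, A \subset B -> B \subset S ->
    `|ieval A z| / ieval A (- t) <= `|ieval B z| / ieval B (- t).
Proof.
move=> zt good A B; have [n] := ubnP #|B|; elim: n A B => // n IH A B leB AB BS.
have [->//|neAB] := eqVneq A B.
have /properP[_ [v vB vA]] : A \proper B by rewrite properEneq neAB.
have ltB : (#|B :\ v| < n)%N by move: leB; rewrite (cardsD1 v) vB.
have BvS : B :\ v \subset S by apply: subset_trans BS; apply: subsetDl.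
have AsB : A \subset B :\ v by rewrite subsetD1 AB.
apply: (le_trans (IH _ _ ltB AsB BvS)).
set U := B :\ v; set W := B :\: cnbh v.
have WU : W \subset U.
  by apply/subsetP => y; rewrite !inE negb_or -andbA => /and3P[-> _ ->].
have qW := IH _ _ ltB WU BvS.
have gU := good _ BvS; have gW := good _ (subset_trans WU BvS); have gB := good _ BS.
rewrite ler_pdivlMr // !(ieval_rec _ vB) -/U -/W mulrDr divfK ?gt_eqF //.
have t0 : 0 <= t := le_trans (normr_ge0 _) zt.
apply: le_trans (lerB_normD _ _); rewrite lerD2l mulNr mulrN lerN2 normrM.
apply: (@le_trans _ _ (t * `|ieval W z|)); first exact: ler_wpM2r.
by rewrite mulrCA ler_wpM2l // -ler_pdivrMr.
Qed.

(** Comparing the empty set with S in [ieval_ratio_homo] gives |I(S, z)| >= I(S, -t) > 0. This is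
    why no complex root is smaller than the first real one. *)
Lemma ieval_neq0 S z t : `|z| <= t ->
  (forall A, A \subset S -> 0 < ieval A (- t)) -> ieval S z != 0.
Proof.
move=> zt good; have := ieval_ratio_homo zt good (sub0set S) (subxx S).
rewrite !ieval0 normr1 divr1 => h; rewrite -normr_gt0.
have := lt_le_trans ltr01 h.
by rewrite pmulr_lgt0 // invr_gt0 good.
Qed.

End Ratio.

Section Real.
Local Open Scope ring_scope.
Variables (R : realType) (G : sgraph).
Implicit Types (t x : R) (S A B : {set G}).

Lemma horner_ieval (K : comNzRingType) S (p : {poly K}) (x : K) : (ieval S p).[x] = ieval S p.[x].
Proof. by rewrite /ieval horner_sum; apply: eq_bigr => T _; rewrite horner_exp. Qed.

Lemma ieval_at0 S : ieval S 0 = 1 :> R.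
Proof.
rewrite /ieval (bigD1 set0) ?sub0set ?indep0 //= cards0 expr0 big1 ?addr0 // => T.
by case/andP=> _; rewrite expr0n cards_eq0 => /negbTE->.
Qed.

Lemma ieval_antimono S t : 0 <= t ->
    (forall A, A \subset S -> 0 <= ieval A (- t)) ->
  forall A B, A \subset B -> B \subset S -> ieval B (- t) <= ieval A (- t).
Proof.
move=> t0 good A B; have [n] := ubnP #|B|; elim: n A B => // n IH A B leB AB BS.
have [->//|neAB] := eqVneq A B.
have /properP[_ [v vB vA]] : A \proper B by rewrite properEneq neAB.
have ltB : (#|B :\ v| < n)%N by move: leB; rewrite (cardsD1 v) vB.
have BvS : B :\ v \subset S by apply: subset_trans BS; apply: subsetDl.
have AsB : A \subset B :\ v by rewrite subsetD1 AB.
apply: le_trans (IH _ _ ltB AsB BvS).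
rewrite (ieval_rec _ vB) -lerBrDl subrr mulNr oppr_le0 mulr_ge0 //.
by apply: good; apply: subset_trans BS; apply: subsetDl.
Qed.

(* tau is the first positive zero of the product of all the I(A, -t), A in S; by
   ieval_antimono it is then also a zero of I(S, -t). *)
Lemma first_zero S : S != set0 ->
  exists tau : R, [/\ 0 < tau, ieval S (- tau) = 0 &
    forall t, 0 <= t < tau -> forall A, A \subset S -> 0 < ieval A (- t)].
Proof.
case/set0Pn => v vS.
pose P A : {poly R} := ieval A (- 'X).
have PE A x : (P A).[x] = ieval A (- x) by rewrite horner_ieval hornerN hornerX.
pose Q := \prod_(A in powerset S) P A.
have QE x : Q.[x] = \prod_(A in powerset S) ieval A (- x).
  by rewrite horner_prod; apply: eq_bigr => A _.
have Q0 : Q.[0] = 1 by rewrite QE big1 // => A _; rewrite oppr0 ieval_at0.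
have Qn0 : Q != 0.
  by apply/eqP => e; move/eqP: Q0; rewrite e horner0 eq_sym oner_eq0.
(* A singleton contributes the factor 1 - t, so a root exists in ]0, 2[, the interval searched
   below. *)
have Q1 : root Q 1.
  rewrite rootE QE (bigD1 [set v]) ?powersetE ?sub1set //=.
  by rewrite ieval_set1 subrr mul0r.
have [tau [tau0 rt nort]] : exists tau, [/\ 0 < tau, root Q tau &
    {in `]0, tau[, forall z, ~~ root Q z}].
  case: (next_rootP Q 0 2) => [/eqP|y _ Qy|c _ _ noroot].
  - by rewrite (negbTE Qn0).
  - by rewrite in_itv => /andP[y0 _]; exists y; split=> //; apply/rootP.
  - by have := noroot 1; rewrite in_itv /= ltr01 ltr1n Q1 => /(_ isT).
have pos t A : 0 <= t < tau -> A \subset S -> 0 < ieval A (- t).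
  case/andP=> t0 ttau AS; rewrite ltNge -PE; apply/negP => le0.
  have ne0 : (P A).[t] != 0.
    move: t0; rewrite le_eqVlt => /predU1P[<-|t0]; first by rewrite PE oppr0 ieval_at0 oner_eq0.
    have := nort t; rewrite in_itv /= t0 ttau => /(_ isT); apply: contra => /eqP e.
    by rewrite rootE QE (bigD1 A) ?powersetE //= -PE e mul0r.
  have lt0 : (P A).[0] * (P A).[t] < 0.
    by rewrite PE oppr0 ieval_at0 mul1r lt_neqAle ne0.
  have [x] := poly_ivtoo t0 lt0; rewrite in_itv /= => /andP[x0 xt] rx.
  have := nort x; rewrite in_itv /= x0 (lt_trans xt ttau) => /(_ isT) /negP; apply.
  by rewrite rootE QE (bigD1 A) ?powersetE //= -PE (rootP rx) mul0r.
exists tau; split=> // [|t tt A AS]; last exact: pos.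
(* The value at 0 is 1, so a negative value at tau would force a zero of I(A, -t) strictly before
   tau. *)
have nneg A : A \subset S -> 0 <= ieval A (- tau).
  move=> AS; rewrite leNgt -PE; apply/negP => ltA.
  have lt0 : (P A).[0] * (P A).[tau] < 0 by rewrite [X in X * _]PE oppr0 ieval_at0 mul1r.
  have [x] := poly_ivtoo (ltW tau0) lt0; rewrite in_itv /= => /andP[x0 xt] /rootP rx.
  by have := pos x A; rewrite (ltW x0) xt -PE rx ltxx => /(_ isT AS).
move: rt; rewrite rootE QE prodf_seq_eq0 => /hasP[A _].
rewrite powersetE => /andP[AS /eqP eA].
apply/eqP; rewrite eq_le nneg // andbT -eA.
exact: (ieval_antimono (ltW tau0) nneg AS).
Qed.

End Real.

Section Xi.
Local Open Scope ring_scope.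
Local Open Scope complex_scope.
Variables (R : realType) (G : sgraph).

Lemma horner_indep_poly (K : comNzRingType) (x : K) :
  (indep_poly G K).[x] = ieval [set: G] x.
Proof.
rewrite /indep_poly horner_poly /ieval.
have lt (T : {set G}) : (#|T| < #|G|.+1)%N by rewrite ltnS max_card.
rewrite (partition_big (fun T : {set G} => Ordinal (lt T)) xpredT) //=.
apply: eq_bigr => k _; rewrite /nb_independent -sum1_card natr_sum big_distrl /=.
apply: eq_big => [T|T]; first by rewrite !inE subsetT.
by rewrite inE mul1r => /andP[_ /eqP->].
Qed.

Lemma ieval_real (S : {set G}) (x : R) : ieval S x%:C = (ieval S x)%:C.
Proof. by rewrite /ieval rmorph_sum; apply: eq_bigr => T _; rewrite rmorphXn. Qed.

(** The bridge from complex moduli to real inequalities: [ieval_neq0] shows that every complex root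
    has modulus at least the first zero tau, and -tau is itself a root. *)
Lemma xiP (x0 : G) :
  [/\ xi G R < 0, ieval [set: G] (xi G R) = 0 &
    forall t, 0 <= t < - xi G R -> forall A : {set G}, 0 < ieval A (- t)].
Proof.
have [|tau [tau0 e pos]] := @first_zero R G setT.
  by apply/set0Pn; exists x0.
suff -> : xi G R = - tau.
  by rewrite oppr_lt0 opprK; split=> // t tt A; apply: (pos t tt); rewrite subsetT.
have norm_real (x : R) : `|x%:C| = `|x|%:C.
  by rewrite normc_def /= expr0n addr0 sqrtr_sqr.
have min_tau (z : R[i]) : root (indep_poly G R[i]) z -> tau%:C <= `|z|.
  rewrite rootE horner_indep_poly => rz.
  have := normr_ge0 z; rewrite normc_def lecR; set t := Num.sqrt _ => t0.
  rewrite lecR leNgt; apply/negP => lt_t.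
  have : ieval [set: G] z != 0.
    apply: (@ieval_neq0 _ _ _ _ t%:C); first by rewrite normc_def.
    by move=> A _; rewrite -rmorphN ieval_real ltcR; apply: pos; rewrite ?t0 ?subsetT.
  by rewrite rz.
have root_tau : root (indep_poly G R[i]) (- tau)%:C.
  by rewrite rootE horner_indep_poly ieval_real e.
apply: classical_sets.xget_unique => [|x [rx minx]].
  split; first exact: root_tau.
  by move=> z /min_tau h; rewrite norm_real normrN gtr0_norm //; exact: h.
have := minx _ root_tau; have := min_tau _ rx.
rewrite !norm_real !lecR normrN (gtr0_norm tau0) => h1 h2.
have ex : `|x| = tau by apply/eqP; rewrite eq_le h1 h2.
(* Minimality only yields |x| = tau. A root x >= 0 is impossible, the coefficients being nonnegative
   and the constant term 1. *)
move: rx; rewrite rootE horner_indep_poly ieval_real.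
case: (ger0P x) ex => [xge0|xlt0] ex; last by rewrite -ex opprK.
rewrite gt_eqF // ltcR /ieval (bigD1 set0) ?sub0set ?indep0 //= cards0 expr0.
by rewrite ltr_wpDr // sumr_ge0 // => T _; rewrite exprn_ge0.
Qed.

End Xi.

Section Compare.
Local Open Scope ring_scope.
Variable R : realType.

(** If xi(A) exceeded xi(B), then t = -xi(A) would lie in the range of the hypothesis while I(A, -t)
    = 0. All later comparisons go through this criterion. *)
Lemma xi_le (A B : sgraph) : (0 < #|A|)%N -> (0 < #|B|)%N ->
  (forall t : R, 0 <= t < - xi B R -> (forall S : {set B}, 0 < ieval S (- t)) ->
     0 < ieval [set: A] (- t)) ->
  xi A R <= xi B R.
Proof.
case/card_gt0P=> a _ /card_gt0P[b _] h.
have [xa ea _] := xiP R a; have [xb eb pb] := xiP R b.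
rewrite leNgt; apply/negP => lt.
have := h (- xi A R); rewrite opprK ea ltxx oppr_ge0 ltrN2 lt (ltW xa) => /(_ isT) h'.
suff: false by []; apply: h' => S.
by have := pb (- xi A R); rewrite opprK oppr_ge0 ltrN2 lt (ltW xa); apply.
Qed.

End Compare.

(** * Rooted trees *)

Section Trees.
Variable G : sgraph.
Implicit Types (v w : G) (A B S : {set G}).

(** Hanging a branch B below the root of A matches the recursion for ratios at the root. The
    rootless [tree], built leaf by leaf, is the form in which trees come out of the peeling. *)
Inductive rooted_tree : {set G} -> G -> Prop :=
| RootedTree1 v : rooted_tree [set v] v
| RootedTreeJoin A v B w : rooted_tree A v -> rooted_tree B w -> [disjoint A & B] ->
    {in A & B, forall x y, adj x y = (x == v) && (y == w)} ->
    rooted_tree (A :|: B) v.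

Inductive tree : {set G} -> Prop :=
| Tree1 v : tree [set v]
| TreeLeaf A a u : tree A -> a \in A -> u \notin A ->
    {in A, forall x, adj u x = (x == a)} -> tree (u |: A).

Lemma root_in A v : rooted_tree A v -> v \in A.
Proof. by elim=> [w|B w C x _ wB _ _ _ _]; rewrite !inE ?eqxx ?wB. Qed.

(** The leaf is pushed down into whichever of the two joined parts contains its neighbour. *)
Lemma rooted_tree_leaf A v a u : rooted_tree A v -> a \in A -> u \notin A ->
  {in A, forall x, adj u x = (x == a)} -> rooted_tree (u |: A) v.
Proof.
elim=> {A v} [v|A v B w tA IHA tB IHB AB ABadj].
  rewrite inE => /eqP-> uv uadj; rewrite setUC; apply: RootedTreeJoin (RootedTree1 v) (RootedTree1 u) _ _.
    by rewrite disjoints1 inE eq_sym; move: uv; rewrite inE.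
  by move=> x y; rewrite !inE => /eqP-> /eqP->; rewrite adj_sym uadj ?inE ?eqxx.
move=> aAB; rewrite inE negb_or => /andP[uA uB] uadj.
have uadjA : {in A, forall x, adj u x = (x == a)} by move=> x xA; apply: uadj; rewrite inE xA.
have uadjB : {in B, forall x, adj u x = (x == a)} by move=> x xB; apply: uadj; rewrite inE xB orbT.
move: aAB; rewrite inE => /orP[aA|aB].
  rewrite setUA; apply: RootedTreeJoin (IHA aA uA uadjA) tB _ _.
    by rewrite -setI_eq0 setIUl setU_eq0 !setI_eq0 disjoints1 uB.
  move=> x y; rewrite !inE => /orP[/eqP->|xA] yB; last exact: ABadj.
  rewrite uadjB //; have -> : (u == v) = false.
    by apply: contraNF uA => /eqP->; apply: root_in tA.
  by apply: contraTF aA => /eqP<-; rewrite (disjointFl AB).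
rewrite setUCA; apply: RootedTreeJoin tA (IHB aB uB uadjB) _ _.
  by rewrite disjoint_sym -setI_eq0 setIUl setU_eq0 !setI_eq0 disjoints1 uA disjoint_sym.
move=> x y xA; rewrite !inE => /orP[/eqP->|yB]; last exact: ABadj.
rewrite adj_sym uadjA //; have -> : (u == w) = false.
  by apply: contraNF uB => /eqP->; apply: root_in tB.
rewrite andbF; apply: contraTF aB => /eqP<-.
by rewrite (disjointFr AB).
Qed.

(** If the root is the newest leaf u, the rest, rooted at the neighbour of u, is a single branch
    below u. *)
Lemma tree_rooted A v : tree A -> v \in A -> rooted_tree A v.
Proof.
move=> tA; elim: tA v => {A} [w v|A a u tA IH aA uA uadj v].
  by rewrite inE => /eqP->; apply: RootedTree1.
rewrite !inE => /predU1P[->|vA]; last exact: rooted_tree_leaf (IH _ vA) aA uA uadj.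
apply: RootedTreeJoin (RootedTree1 u) (IH a aA) _ _.
  by rewrite disjoints1.
by move=> x y; rewrite inE => /eqP-> yA; rewrite uadj // eqxx.
Qed.

(** One vertex is removed from the last branch, or the whole branch when it is a single vertex. This
    supplies the smaller tree needed in [tree_path_bound]. *)
Lemma rooted_tree_prune A v : rooted_tree A v -> 1 < #|A| ->
  exists2 B, rooted_tree B v & B \subset A /\ #|B|.+1 = #|A|.
Proof.
elim=> {A v} [v|A v B w tA _ tB IHB AB ABadj _]; first by rewrite cards1.
have [B1|B2] := leqP #|B| 1.
  exists A => //; split; first exact: subsetUl.
  rewrite cardsU disjoint_setI0 // cards0 subn0.
  suff -> : #|B| = 1 by rewrite addn1.
  by apply/eqP; rewrite eqn_leq B1 card_gt0; apply/set0Pn; exists w; apply: root_in tB.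
have [B' tB' [B'B cB]] := IHB B2.
have AB' : [disjoint A & B'] by apply: disjointWr B'B AB.
exists (A :|: B').
  apply: RootedTreeJoin tA tB' AB' _.
  by move=> x y xA yB; apply: ABadj => //; apply: (subsetP B'B).
split; first exact: setUS.
by rewrite !cardsU !disjoint_setI0 // cards0 !subn0 -cB addnS.
Qed.

End Trees.

Section TreeValues.
Local Open Scope ring_scope.
Variables (K : comNzRingType) (G : sgraph).
Implicit Types (x : K) (v w : G) (A B S : {set G}).

Lemma ieval_disjoint A B x : [disjoint A & B] -> {in A & B, forall a b, ~~ adj a b} ->
  ieval (A :|: B) x = ieval A x * ieval B x.
Proof.
have [n] := ubnP #|A|; elim: n A => // n IH A leA AB ABadj.
case: (set_0Vmem A) => [->|[v vA]]; first by rewrite set0U ieval0 mul1r.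
have vB : v \notin B by rewrite (disjointFr AB).
have vAB : v \in A :|: B by rewrite inE vA.
have sub1 : A :\ v \subset A := subsetDl _ _.
have sub2 : A :\: cnbh v \subset A := subsetDl _ _.
have lt (C : {set G}) : C \subset A -> v \notin C -> (#|C| < n)%N.
  move=> CA vC; have /proper_card ltCA : C \proper A by apply/properP; split=> //; exists v.
  exact: leq_trans ltCA leA.
have IH' (C : {set G}) : C \subset A -> v \notin C -> ieval (C :|: B) x = ieval C x * ieval B x.
  move=> CA vC; apply: IH; first exact: lt.
    exact: disjointWl AB.
  by move=> a b /(subsetP CA); apply: ABadj.
rewrite (ieval_rec _ vAB) (ieval_rec _ vA) mulrDl -mulrA -!IH' //.
- congr (_ + _ * _); congr (ieval _ _).
    by apply/setP => y; rewrite !inE; case: eqP => // ->; rewrite (negbTE vB).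
  apply/setP => y; rewrite !inE; case yB: (y \in B); last by rewrite !orbF.
  rewrite !orbT andbT negb_or ABadj // andbT.
  by apply: contraNneq vB => <-.
- by rewrite !inE eqxx.
- by rewrite !inE eqxx.
Qed.

(** Without v the two parts separate; choosing v forbids w. For r_A = I(A) / I(A - v) and r_B = I(B)
    / I(B - w) this reads r = 1 + (r_A - 1) / r_B, which is nondecreasing in both ratios while r_A
    <= 1 and r_B > 0. *)
Lemma ieval_join A v B w x : v \in A -> w \in B -> [disjoint A & B] ->
    {in A & B, forall a b, adj a b = (a == v) && (b == w)} ->
  ieval ((A :|: B) :\ v) x = ieval (A :\ v) x * ieval B x /\
  ieval (A :|: B) x =
    ieval (A :\ v) x * ieval B x + (ieval A x - ieval (A :\ v) x) * ieval (B :\ w) x.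
Proof.
move=> vA wB AB ABadj.
have vB : v \notin B by rewrite (disjointFr AB).
have vAB : v \in A :|: B by rewrite inE vA.
have e : ieval ((A :|: B) :\ v) x = ieval (A :\ v) x * ieval B x.
  rewrite -ieval_disjoint.
  - congr (ieval _ _); apply/setP => y; rewrite !inE.
    by case: eqP => // ->; rewrite (negbTE vB).
  - by apply: disjointWl AB; apply: subsetDl.
  - by move=> a b; rewrite !inE => /andP[/negbTE av aA] bB; rewrite ABadj // av.
split=> //; rewrite (ieval_rec _ vAB) (ieval_rec x vA) e.
suff -> : ieval ((A :|: B) :\: cnbh v) x = ieval (A :\: cnbh v) x * ieval (B :\ w) x by ring.
rewrite -ieval_disjoint.
- congr (ieval _ _); apply/setP => y; rewrite !inE.
  case yB: (y \in B); last by rewrite andbF !orbF.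
  rewrite !orbT (disjointFl AB yB) andbF ABadj // eqxx /= !andbT.
  by have -> : (y == v) = false by apply: contraNF vB => /eqP<-.
- apply: disjointWl (subsetDl _ _) _; apply: disjointWr (subsetDl _ _) AB.
- move=> a b; rewrite !inE => /andP[_ aA] /andP[/negbTE bw bB].
  by rewrite ABadj // bw andbF.
Qed.

Fixpoint path_value x k := match k with
  | 0 => 1
  | k'.+1 => match k' with
    | 0 => 1 + x
    | k''.+1 => path_value x k' + x * path_value x k''
    end
  end.

Lemma path_valueSS x k :
  path_value x k.+2 = path_value x k.+1 + x * path_value x k.
Proof. by []. Qed.

(** This is [ieval_join] for paths on i + 1 and j + 1 vertices joined end to end. The difference
    p_(i+1) - p_i stands for x p_(i-1), which spares a separate case i = 0. *)
Lemma path_value_split x i j :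
  path_value x (i + j).+2 =
  path_value x i * path_value x j.+1 - (path_value x i - path_value x i.+1) * path_value x j.
Proof.
(* The recursion has order two, so the induction carries two consecutive values of i. *)
suff : path_value x (i + j).+2 =
    path_value x i * path_value x j.+1 - (path_value x i - path_value x i.+1) * path_value x j /\
  path_value x (i.+1 + j).+2 =
    path_value x i.+1 * path_value x j.+1 - (path_value x i.+1 - path_value x i.+2) * path_value x j.
  by case.
have pv0 : path_value x 0 = 1 by [].
have pv1 : path_value x 1 = 1 + x by [].
elim: i => [|i [IH1 IH2]]; first by rewrite add0n add1n !path_valueSS pv0 pv1; split; ring.
split=> //; rewrite !addSn path_valueSS -addSn IH2 IH1 !(path_valueSS x i) !(path_valueSS x i.+1) !(path_valueSS x i).
ring.
Qed.

Lemma ieval_path (f : nat -> G) k x : uniq (mkseq f k) ->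
    (forall i j, (i < j < k)%N -> adj (f i) (f j) = (j == i.+1)) ->
  ieval [set y in mkseq f k] x = path_value x k.
Proof.
have [n] := ubnP k; elim: n k => // n IH [|[|k]] ltk.
- move=> _ _; rewrite (_ : [set y in mkseq f 0] = set0) ?ieval0 //.
- move=> _ _; have -> : [set y in mkseq f 1] = [set f 0] by apply/setP => y; rewrite !inE.
  by rewrite ieval_set1.
move=> uf fadj; rewrite path_valueSS.
have uf1 : uniq (mkseq f k.+1) by move: uf; rewrite mkseqS rcons_uniq => /andP[].
have uf0 : uniq (mkseq f k) by move: uf1; rewrite mkseqS rcons_uniq => /andP[].
rewrite -(IH k.+1) //; last by move=> i j ij; apply: fadj; lia.
rewrite -(IH k) //; [|lia|by move=> i j ij; apply: fadj; lia].
have fk : f k.+1 \in [set y in mkseq f k.+2] by rewrite inE mkseqS mem_rcons inE eqxx.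
have fk1 : f k.+1 \notin mkseq f k.+1 by move: uf; rewrite mkseqS rcons_uniq => /andP[].
rewrite (ieval_rec _ fk); congr (_ + _ * _); congr (ieval _ _); apply/setP => y.
  rewrite in_setD1 !in_set [in LHS]mkseqS mem_rcons in_cons; case: eqP => [->|//].
  by rewrite (negbTE fk1).
rewrite in_setD !in_set [in LHS]mkseqS mem_rcons in_cons; case: eqVneq => [->|ny] /=.
  by apply/esym; apply: contraNF fk1; rewrite mkseqS mem_rcons in_cons => ->; rewrite orbT.
apply/andP/idP => [[nadj]|].
  rewrite mkseqS mem_rcons in_cons => /predU1P[e|//].
  by move: nadj; rewrite e adj_sym fadj ?eqxx // !ltnS leqnn.
move=> yk; split; last by rewrite mkseqS mem_rcons in_cons yk orbT.
case/mapP: yk => i; rewrite mem_iota add0n => /andP[_ ik] ->.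
by rewrite adj_sym fadj //; lia.
Qed.

End TreeValues.

(** * Extremal ratios at the root of a tree *)

Section TreeBounds.
Local Open Scope ring_scope.
Variables (R : realFieldType) (G : sgraph) (y : R).
Hypothesis y0 : 0 <= y.
Implicit Types (v w : G) (A B S : {set G}).

Let p k := path_value (- y) k.

(* Among rooted trees on m + 1 vertices, the star rooted at its centre has the
   least ratio I(A, -y) / I(A - v, -y). *)
Lemma tree_star_bound A v M : rooted_tree A v ->
    y < (1 - y) ^+ M -> 0 < 1 - y -> forall m, #|A| = m.+1 -> (m <= M)%N ->
  [/\ 0 < ieval (A :\ v) (- y), 0 < ieval A (- y) &
   ieval (A :\ v) (- y) * ((1 - y) ^+ m - y) <= ieval A (- y) * (1 - y) ^+ m].
Proof.
move=> tA yM q0; set q := 1 - y in yM q0 *.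
have qle1 : q <= 1 by rewrite /q lerBlDr lerDl.
have qpow m : (m <= M)%N -> y < q ^+ m.
  by move=> mM; apply: lt_le_trans yM _; apply: ler_wiXn2l => //; exact: ltW.
(* For the star with m leaves, q^m - y and q^m are the values with and without the centre.
   Positivity of I(A, -y) follows from the bound, as y < q^m. *)
suff main : forall m, #|A| = m.+1 -> (m <= M)%N -> 0 < ieval (A :\ v) (- y) /\
   ieval (A :\ v) (- y) * (q ^+ m - y) <= ieval A (- y) * q ^+ m.
  move=> m cA mM; have [h1 h2] := main m cA mM; split=> //.
  rewrite -(pmulr_lgt0 _ (exprn_gt0 m q0)); apply: lt_le_trans h2.
  by rewrite mulr_gt0 // subr_gt0 qpow.
elim: tA => {A v} [v|A v B w tA IHA tB IHB AB ABadj] m.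
  rewrite cards1 => -[<-] _; rewrite setDv ieval0; split=> //.
  by rewrite expr0 mulr1 mul1r ieval_set1.
have vA := root_in tA; have wB := root_in tB.
have [-> ->] := ieval_join (- y) vA wB AB ABadj.
rewrite cardsU disjoint_setI0 // cards0 subn0.
have [i cA] : exists i, #|A| = i.+1 by exists #|A|.-1; rewrite prednK // card_gt0; apply/set0Pn; exists v.
have [j cB] : exists j, #|B| = j.+1 by exists #|B|.-1; rewrite prednK // card_gt0; apply/set0Pn; exists w.
rewrite cA cB addSn addnS => -[<-] ijM.
have iM : (i <= M)%N by lia.
have jM : (j < M)%N by lia.
have [a'0 ha] := IHA i cA iM.
have [b'0 hb] := IHB j cB (ltnW jM).
move: a'0 ha b'0 hb.
set a := ieval A _; set a' := ieval (A :\ v) _; set b := ieval B _; set b' := ieval (B :\ w) _.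
move=> a'0 ha b'0 hb.
have yj : y < q ^+ j by apply: qpow; apply: ltnW.
have yj1 : y < q ^+ j.+1 by apply: qpow.
have qj0 : 0 < q ^+ j by rewrite exprn_gt0.
have qi0 : 0 < q ^+ i by rewrite exprn_gt0.
have b0 : 0 < b.
  rewrite -(pmulr_lgt0 _ qj0); apply: lt_le_trans hb.
  by rewrite mulr_gt0 // subr_gt0.
split; first by rewrite mulr_gt0.
have uq : q ^+ j.+1 <= q by rewrite -[leRHS]expr1; apply: ler_wiXn2l => //; exact: ltW.
(* With u = q^(j+1) and after multiplication by q, the difference of the two sides is (q - u)(u -
   y), where y < u <= q. It yields b / b' >= q^(j+1): a branch on j + 1 vertices lowers the ratio at
   v at most as much as j + 1 leaves at v do. *)
have hu : q ^+ j.+1 * q ^+ j <= q ^+ j - y.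
  rewrite -(ler_pM2l q0).
  have : 0 <= (q - q ^+ j.+1) * (q ^+ j.+1 - y) by rewrite mulr_ge0 // subr_ge0 // ltW.
  have -> : y = 1 - q by rewrite /q; ring.
  rewrite exprS; nra.
have hb' : b' * q ^+ j.+1 <= b.
  rewrite -(ler_pM2r qj0); apply: le_trans hb.
  by rewrite -mulrA ler_pM2l.
have -> : q ^+ (i + j).+1 = q ^+ i * q ^+ j.+1 by rewrite -exprD addnS.
have ha' : (a' - a) * q ^+ i <= a' * y by move: ha; nra.
have qj1 : 0 < q ^+ j.+1 by rewrite exprn_gt0.
have h1 : (a' - a) * q ^+ i * (b' * q ^+ j.+1) <= a' * y * (b' * q ^+ j.+1).
  by rewrite ler_pM2r // mulr_gt0.
have h2 : a' * y * (b' * q ^+ j.+1) <= a' * y * b by rewrite ler_wpM2l // mulr_ge0 // ltW.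
have := le_trans h1 h2; nra.
Qed.

(* Among rooted trees on m + 1 vertices, the path rooted at an end has the
   greatest ratio I(A, -y) / I(A - v, -y). *)
Lemma tree_path_bound A v : rooted_tree A v ->
    (forall B, B \subset A -> 0 < ieval B (- y)) -> forall m, #|A| = m.+1 ->
  (forall j, (j <= m.+1)%N -> 0 < p j) /\
  ieval A (- y) * p m <= p m.+1 * ieval (A :\ v) (- y).
Proof.
have [n] := ubnP #|A|; elim: n A v => // n IH A v ltA tA good m cA.
case: tA ltA good cA => {A v} [v _ good|A v B w tA tB AB ABadj ltA good].
  rewrite cards1 => -[<-]; have e : ieval [set v] (- y) = 1 - y by rewrite ieval_set1.
  rewrite setDv ieval0 e /p /=; split=> [[|[|//]] _ //=|]; last by rewrite !mulr1.
  by have := good _ (subxx _); rewrite e.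
have vA := root_in tA; have wB := root_in tB.
have tAB : rooted_tree (A :|: B) v by apply: RootedTreeJoin tA tB AB ABadj.
have [e1 e2] := ieval_join (- y) vA wB AB ABadj.
have cAB : #|A :|: B| = (#|A| + #|B|)%N by rewrite cardsU disjoint_setI0 // cards0 subn0.
have [i cA] : exists i, #|A| = i.+1 by exists #|A|.-1; rewrite prednK // card_gt0; apply/set0Pn; exists v.
have [j cB] : exists j, #|B| = j.+1 by exists #|B|.-1; rewrite prednK // card_gt0; apply/set0Pn; exists w.
(* Applied to the pruned tree, the induction hypothesis makes the path values positive up to index i
   + j + 1; only the top one, i + j + 2, is left for [key]. *)
have [|C tC [CAB cC]] := rooted_tree_prune tAB; first by rewrite cAB cA cB; lia.
move=> cAm; have {cAm m} -> : m = (i + j).+1 by move: cAm; rewrite cAB cA cB; lia.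
have goodS (C' : {set G}) : C' \subset A :|: B -> forall D : {set G}, D \subset C' -> 0 < ieval D (- y).
  by move=> sub D DC; apply: good; apply: subset_trans sub.
have [pA ha] := IH A v ltac:(lia) tA (goodS _ (subsetUl _ _)) _ cA.
have [pB hb] := IH B w ltac:(lia) tB (goodS _ (subsetUr _ _)) _ cB.
have cC' : #|C| = (i + j).+1 by lia.
have [pC _] := IH C v ltac:(lia) tC (goodS _ CAB) _ cC'.
have tot0 : 0 < ieval (A :|: B) (- y) by apply: good.
have a'0 : 0 < ieval (A :\ v) (- y).
  by apply: good; apply: subset_trans (subsetUl _ _); apply: subsetDl.
have b'0 : 0 < ieval (B :\ w) (- y).
  by apply: good; apply: subset_trans (subsetUr _ _); apply: subsetDl.
have b0 : 0 < ieval B (- y) by apply: good; apply: subsetUr.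
move: tot0 a'0 b'0 b0 ha hb; rewrite e1 e2.
set a := ieval A _; set a' := ieval (A :\ v) _; set b := ieval B _; set b' := ieval (B :\ w) _.
move=> tot0 a'0 b'0 b0 ha hb.
(* The path values decrease: beyond the first step, the difference is y times an earlier value. *)
have decr k : (k <= (i + j))%N -> 0 <= p k - p k.+1.
  case: k => [|k] kij; first by rewrite /p /= opprD opprK addNKr.
  have -> : p k.+1 - p k.+2 = y * p k by rewrite /p path_valueSS; ring.
  by apply: mulr_ge0 => //; apply/ltW/pC/leqW/ltnW.
have pi0 : 0 < p i by apply: pA.
have pj0 : 0 < p j by apply: pB.
have pj1 : 0 < p j.+1 by apply: pB.
(* Replacing both parts by paths rooted at an end can only raise the ratio. The result is the path
   on i + j + 2 vertices rooted at its (i+1)-st vertex. *)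
have key : (a' * b + (a - a') * b') * (p i * p j.+1) <= a' * b * p (i + j).+2.
  rewrite [in leRHS]/p path_value_split -/(p _) -/(p _) -/(p _) -/(p _).
  have h1 : a' * (p i - p i.+1) <= (a' - a) * p i.
    by rewrite mulrBr mulrBl lerB // mulrC [leRHS]mulrC mulrC.
  have h2 : a' * (p i - p i.+1) * (b * p j) <= (a' - a) * p i * (b' * p j.+1).
    apply: ler_pM => //; last by rewrite [leRHS]mulrC.
      by apply: mulr_ge0; [exact: ltW|apply/decr/leq_addr].
    by apply: mulr_ge0; exact: ltW.
  rewrite -subr_ge0.
  have -> : a' * b * (p i * p j.+1 - (p i - p i.+1) * p j) - (a' * b + (a - a') * b') * (p i * p j.+1) =
    (a' - a) * p i * (b' * p j.+1) - a' * (p i - p i.+1) * (b * p j) by ring.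
  by rewrite subr_ge0.
have pn0 : 0 < p (i + j).+2.
  have : 0 < a' * b * p (i + j).+2.
    by apply: lt_le_trans key; rewrite mulr_gt0 // mulr_gt0.
  by rewrite pmulr_rgt0 // mulr_gt0.
split.
  move=> k; rewrite leq_eqVlt => /predU1P[->//|lek]; exact: pC.
apply: le_trans (_ : (a' * b + (a - a') * b') * (p i * p j.+1) <= _); last by rewrite [leRHS]mulrC.
(* Moving the root to an end raises the ratio further, that is, p_(i+j+1) <= p_i p_(j+1). For i > 0
   the gap is (p_(i-1) - p_i)(p_j - p_(j+1)), a product of nonnegative differences. *)
rewrite ler_pM2l //.
case: i {cA ha pi0 key pn0 pA cC' pC} decr => [|i] decr; first by rewrite add0n /p mul1r.
rewrite addSn [in leLHS]/p path_value_split -/(p _) -/(p _) -/(p _) -/(p _).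
have : 0 <= (p i - p i.+1) * (p j - p j.+1).
  by apply: mulr_ge0; apply: decr; rewrite addSn ?leqW ?leq_addr ?leq_addl.
by rewrite -[in X in _ -> X]subr_ge0; congr (0 <= _); ring.
Qed.

End TreeBounds.

(** * Graphs with a unique cycle *)

Section Paths.
Variable G : sgraph.
Implicit Types (x y z : G) (A : {set G}) (c p : seq G).

Lemma maximal_path A x : x \in A -> exists z p,
  [/\ path adj z p, uniq (z :: p), {subset z :: p <= A}, last z p = x &
      {in A, forall y, adj z y -> y \in p}].
Proof.
move=> xA.
have main n z p : path adj z p -> uniq (z :: p) -> {subset z :: p <= A} -> last z p = x ->
    #|A| <= size p + n -> exists z p,
  [/\ path adj z p, uniq (z :: p), {subset z :: p <= A}, last z p = x &
      {in A, forall y, adj z y -> y \in p}].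
  elim: n z p => [|n IH] z p pz up sub lz leA.
    have : #|z :: p| <= #|A| by apply: subset_leq_card; apply/subsetP.
    by rewrite (card_uniqP up) /= => lt; move: (leq_trans lt leA); rewrite addn0 ltnn.
  case: (boolP [exists y in A, adj z y && (y \notin p)]) => [/exists_inP[y yA /andP[zy yp]]|].
    apply: (IH y (z :: p)) => //.
    - by rewrite /= adj_sym zy.
    - rewrite /= in up *; rewrite inE negb_or yp up !andbT.
      by apply: contraTneq zy => ->; rewrite adj_irr.
    - by move=> w; rewrite inE => /predU1P[->//|]; apply: sub.
    - by rewrite addSnnS.
  rewrite negb_exists_in => /forall_inP h; exists z, p; split=> // y yA zy.
  by have := h y yA; rewrite zy negbK.
apply: (main #|A| x [::]) => //= w; by rewrite inE => /eqP->.
Qed.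

(** The head of a maximal path sees only vertices of the path, and a neighbour beyond the second
    vertex would close a cycle inside A. *)
Lemma acyclic_maximal_path A x : x \in A ->
    (forall c, is_cycle c -> ~ {subset c <= A}) ->
  exists z p, [/\ path adj z p, uniq (z :: p), {subset z :: p <= A}, last z p = x &
      {in A, forall y, adj z y -> ohead p = Some y}].
Proof.
move=> xA acyc; have [z [p [pz up sub lz h]]] := maximal_path xA.
exists z, p; split=> // y yA zy; have := h y yA zy => yp.
case/splitPr: yp pz up sub {lz h} => [[//|w p1] p2] pz up sub; exfalso.
have e : z :: (w :: p1) ++ y :: p2 = (z :: rcons (w :: p1) y) ++ p2 by rewrite /= cat_rcons.
apply: (acyc (z :: rcons (w :: p1) y)); last by move=> t tin; apply: sub; rewrite e mem_cat tin.
rewrite /is_cycle /ucycleb; move: up; rewrite e cat_uniq => /andP[-> _]; rewrite andbT.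
apply/andP; split; first by rewrite /= size_rcons.
move: pz; rewrite -cat_rcons cat_path => /andP[pz1 _].
by rewrite /cycle rcons_path pz1 last_rcons adj_sym zy.
Qed.

Lemma acyclic_low_degree A : A != set0 ->
    (forall c, is_cycle c -> ~ {subset c <= A}) ->
  exists2 z, z \in A & {in A &, forall y y', adj z y -> adj z y' -> y = y'}.
Proof.
case/set0Pn=> x xA acyc; have [z [p [_ _ sub _ h]]] := acyclic_maximal_path xA acyc.
exists z; first by apply: sub; rewrite inE eqxx.
move=> y y' yA y'A zy zy'; have := h _ yA zy; rewrite (h _ y'A zy').
by case.
Qed.

(** The Boolean equation also excludes chords: the cycle is induced. *)
Definition cycle_numbering (f : nat -> G) n :=
  uniq (mkseq f n) /\
  forall i j, i < j < n -> adj (f i) (f j) = (j == i.+1) || (i == 0) && (j == n.-1).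

End Paths.

Lemma mkseq_mem (T : eqType) (f : nat -> T) n y :
  reflect (exists2 i, i < n & y = f i) (y \in mkseq f n).
Proof.
apply: (iffP mapP) => -[i ik ->]; exists i => //; first by move: ik; rewrite mem_iota.
by rewrite mem_iota.
Qed.

Lemma mkseq_inj (T : eqType) (f : nat -> T) n i j :
  uniq (mkseq f n) -> i < n -> j < n -> f i = f j -> i = j.
Proof.
move=> uf ilt jlt e; apply/eqP; rewrite -(nth_uniq (f 0) _ _ uf) ?size_mkseq //.
by rewrite !nth_mkseq ?e.
Qed.

Section CycleValue.
Local Open Scope ring_scope.
Variables (K : comNzRingType) (G : sgraph).

Lemma ieval_cycle (f : nat -> G) n (x : K) : cycle_numbering f n.+3 ->
  ieval [set y in mkseq f n.+3] x = path_value x n.+2 + x * path_value x n.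
Proof.
case=> uf fadj.
have ufS k : (k <= n.+3)%N -> uniq (mkseq f k).
  move=> kn; have -> : mkseq f k = take k (mkseq f n.+3).
    by rewrite /mkseq -map_take take_iota (minn_idPl kn).
  by rewrite take_uniq.
have finj i j := @mkseq_inj _ f n.+3 i j uf.
have uf1 : uniq (mkseq (fun i => f i.+1) n).
  apply/(uniqP (f 0)) => i j; rewrite !inE !size_mkseq => il jl.
  by rewrite !nth_mkseq // => /finj e; apply: succn_inj; apply: e; rewrite !ltnS ltnW // ltnW.
have fn : f n.+2 \in [set y in mkseq f n.+3] by rewrite in_set; apply/mkseq_mem; exists n.+2.
rewrite (ieval_rec _ fn); congr (_ + _ * _).
  rewrite -(@ieval_path K G f n.+2) ?ufS //; last first.
    by move=> i j ij; rewrite fadj; lia.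
  congr (ieval _ _); apply/setP => y; rewrite in_setD1 !in_set; apply/andP/mkseq_mem.
    case=> ny /mkseq_mem[i ilt e]; exists i => //.
    by move: ilt; rewrite ltnS leq_eqVlt => /predU1P[ei|//]; rewrite e ei eqxx in ny.
  case=> i ilt e; split; last by apply/mkseq_mem; exists i; rewrite // ltnW.
  by apply/eqP; rewrite e => /finj; lia.
rewrite -(@ieval_path K G (fun i => f i.+1) n) //; last first.
  by move=> i j ij; rewrite fadj; lia.
congr (ieval _ _); apply/setP => y; rewrite in_setD !in_set; apply/andP/mkseq_mem.
  case=> ny /mkseq_mem[i ilt e]; move: ny; rewrite e negb_or => /andP[ny nadj].
  have ilt2 : (i < n.+2)%N.
    by move: ilt; rewrite ltnS leq_eqVlt => /predU1P[ei|//]; rewrite ei eqxx in ny.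
  move: nadj; rewrite adj_sym fadj ?ilt2 //= eqxx andbT negb_or => /andP[in1 i0].
  by case: i {ny ilt} i0 in1 e ilt2 => // i _ in1 e ilt2; exists i => //; lia.
case=> i ilt e; split; last by apply/mkseq_mem; exists i.+1 => //; lia.
rewrite negb_or e adj_sym fadj; last by lia.
by apply/andP; split; [apply/eqP => /finj; lia|lia].
Qed.

End CycleValue.

Section UniqueCycle.
Variables (G : sgraph) (c : seq G).
Hypothesis c_cycle : is_cycle c.
Hypothesis c_unique : forall c', is_cycle c' -> c' =i c.
Implicit Types (x y z : G) (A : {set G}) (p : seq G).

Let C : {set G} := [set x in c].

(** A chord closes the segment of [c] between its ends into a strictly shorter cycle, against the
    equality of vertex sets. *)
Lemma cycle_chordless x0 : cycle_numbering (nth x0 c) (size c).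
Proof.
have /and3P[c2 cyc uc] : [&& 2 < size c, cycle adj c & uniq c] by move: c_cycle.
split; first by rewrite mkseq_nth.
move=> i j /andP[ij jn]; apply/idP/orP => [|].
  move=> aij; case: (eqVneq j i.+1) => [|nij]; first by left.
  right; rewrite -[_ && _]negbK; apply/negP => n0.
  pose c' := take (j - i).+1 (drop i c).
  have sc' : size c' = (j - i).+1 by rewrite size_takel // size_drop; lia.
  have uc' : uniq c' by rewrite take_uniq // drop_uniq.
  have c'_cycle : is_cycle c'.
    rewrite /is_cycle /ucycleb sc' uc' andbT; apply/andP; split; first lia.
    have sc : sorted adj c'.
      by apply/take_sorted/drop_sorted; case: (c) cyc => //= a s; rewrite rcons_path => /andP[].
    have n0' : nth x0 c' 0 = nth x0 c i by rewrite nth_take // nth_drop addn0.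
    have nl : nth x0 c' (size c').-1 = nth x0 c j.
      by rewrite sc' /= nth_take // nth_drop subnKC // ltnW.
    case: c' sc n0' nl {sc' uc'} => [|a s] //= ps ea nl.
    by rewrite rcons_path ps /= (last_nth x0) nl ea adj_sym.
  have : size c == size c' by rewrite -(uniq_size_uniq uc' (c_unique c'_cycle)).
  by rewrite sc'; lia.
case: (c) cyc jn ij => //= a s ps; rewrite ltnS => jn ij.
move/(pathP x0): ps; rewrite size_rcons => ps.
case=> [/eqP ej|/andP[/eqP-> /eqP ej]].
  have := ps i; rewrite ej nth_rcons -rcons_cons nth_rcons /=; move: jn; rewrite ej => jn.
  by rewrite ltnS (ltnW jn) jn; apply.
have := ps (size s); rewrite ltnSn => /(_ isT); rewrite ej nth_rcons ltnn eqxx.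
by rewrite -rcons_cons nth_rcons /= ltnSn adj_sym.
Qed.

(** A path outside C with both ends attached to C closes up to a cycle through z, which is not on
    [c]: along an arc of C if y and y0 differ, through y alone otherwise. The last condition
    discards the degenerate case of a single edge used twice. *)
Lemma no_ear z p x y y0 : path adj z p -> uniq (z :: p) -> {subset z :: p <= ~: C} ->
  last z p = x -> y0 \in C -> y \in C -> adj x y0 -> adj z y -> (y != y0) || (p != [::]) ->
  False.
Proof.
move=> pz up sub lz y0C yC xy0 zy cond.
have /and3P[c2 cyc uc] : [&& 2 < size c, cycle adj c & uniq c] by move: c_cycle.
have zC : z \notin c by have := sub z; rewrite !inE eqxx => /(_ isT).
have notC w : w \in c -> w \notin z :: p.
  by move=> wc; apply/negP => /sub; rewrite !inE wc.
rewrite !inE in y0C yC.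
case: (eqVneq y y0) cond => [ey|ney] /= cond.
  have c'_cycle : is_cycle (y :: z :: p).
    rewrite /is_cycle /ucycleb /= rcons_path pz lz {2}ey xy0 adj_sym zy /=.
    rewrite /= in up; rewrite up andbT (notC _ yC) andbT.
    by case: p cond {pz up sub lz notC}.
  by move/negP: zC; apply; rewrite -(c_unique c'_cycle) !inE eqxx orbT.
have [i s ec] := rot_to y0C.
have : y \in y0 :: s by rewrite -ec mem_rot.
rewrite inE (negbTE ney) /= => ys.
move: cyc uc; rewrite -(rot_cycle i) -(rot_uniq i) ec.
have sc w : w \in y0 :: s -> w \notin z :: p by rewrite -ec mem_rot; apply: notC.
case/splitPr: ys sc {ec} => s1 s2 sc.
rewrite /cycle -cat_rcons rcons_cat cat_path => /andP[ps1 _].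
rewrite -cat_cons cat_uniq => /andP[us1 _].
have c'_cycle : is_cycle ((y0 :: rcons s1 y) ++ z :: p).
  rewrite /is_cycle /ucycleb cat_uniq us1 up andbT.
  apply/and3P; split.
  - by rewrite /= size_cat size_rcons /= addSn addnS.
  - rewrite /= rcons_cat cat_path ps1 /= last_rcons adj_sym zy.
    by rewrite rcons_path pz lz.
  - apply/hasPn => w; apply: contraTN => /= win; apply: sc.
    by move: win; rewrite !inE mem_rcons mem_cat !inE => /or3P[->|->|->]; rewrite ?orbT.
by move/negP: zC; apply; rewrite -(c_unique c'_cycle) mem_cat mem_head orbT.
Qed.

Lemma acyclicN A : ~~ (C \subset A) -> forall c', is_cycle c' -> ~ {subset c' <= A}.
Proof.
move=> /negP nCA c' c'_cycle sub; apply: nCA; apply/subsetP => x; rewrite inE => xc.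
by apply: sub; rewrite (c_unique c'_cycle).
Qed.

(** If some x outside C touches C, take a maximal outside path ending at x. By [no_ear], its head z
    can touch C only when the path is x alone, and then only at y0; such a z has no outside
    neighbour. If nothing outside touches C, low degree outside C is enough. *)
Lemma low_degree_outside A : C \subset A -> A != C ->
  exists2 z, z \in A :\: C & {in A &, forall y y', adj z y -> adj z y' -> y = y'}.
Proof.
move=> CA nAC; set B := A :\: C.
have Bn0 : B != set0 by rewrite setD_eq0; apply: contra nAC => AsC; rewrite eqEsubset AsC CA.
have Bacyc c' : is_cycle c' -> ~ {subset c' <= B}.
  apply: acyclicN; apply/negP => /subsetP CB.
  have /and3P[c2 _ _] : [&& 2 < size c, cycle adj c & uniq c] by move: c_cycle.
  have [x xc] : exists x, x \in c by case: (c) c2 => // x s _; exists x; rewrite inE eqxx.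
  by have := CB x; rewrite !inE xc => /(_ isT).
case: (boolP [exists x in B, [exists y0 in C, adj x y0]]); last first.
  rewrite negb_exists_in => /forall_inP nadj.
  have [z zB hz] := acyclic_low_degree Bn0 Bacyc; exists z => //.
  have inB y : y \in A -> adj z y -> y \in B.
    move=> yA zy; rewrite inE yA andbT; apply/negP => yC.
    by have /exists_inP := nadj z zB; case; exists y.
  by move=> y y' yA y'A zy zy'; apply: hz => //; apply: inB.
case/exists_inP=> x xB /exists_inP[y0 y0C xy0].
have [z [p [pz up sub lz hz]]] := acyclic_maximal_path xB Bacyc.
have zB : z \in B by apply: sub; rewrite inE eqxx.
have sub' : {subset z :: p <= ~: C} by move=> w /sub; rewrite !inE => /andP[].
exists z => // y y' yA y'A zy zy'; apply/eqP/negPn/negP => nyy'.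
have ear w : w \in C -> adj z w -> (w = y0) /\ p = [::].
  move=> wC zw; case: (eqVneq w y0) => [->|nw]; case: (eqVneq p [::]) => // np; exfalso;
  by apply: (no_ear pz up sub' lz y0C wC xy0 zw); rewrite ?np ?nw ?orbT.
have inB w : w \in A -> w \notin C -> w \in B by move=> wA wC; rewrite inE wC.
case: (boolP (y \in C)) => yC; case: (boolP (y' \in C)) => y'C.
- by move: nyy'; rewrite (ear _ yC zy).1 (ear _ y'C zy').1 eqxx.
- by have := hz _ (inB _ y'A y'C) zy'; rewrite (ear _ yC zy).2.
- by have := hz _ (inB _ yA yC) zy; rewrite (ear _ y'C zy').2.
- have := hz _ (inB _ yA yC) zy; rewrite (hz _ (inB _ y'A y'C) zy') => -[e].
  by rewrite e eqxx in nyy'.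
Qed.

End UniqueCycle.

(** * Well-covered unicyclic graphs of odd order *)

Section WellCovered.
Variable G : sgraph.
Implicit Types (u v w x y z a b : G) (S U X Y : {set G}).

Definition dominates X z : bool := [exists x in X, z \in cnbh x].

Lemma dominatesP X z : reflect (exists2 x, x \in X & (z == x) || adj x z) (dominates X z).
Proof.
by apply: (iffP exists_inP) => -[x xX h]; exists x => //; move: h; rewrite inE.
Qed.

(* For S the whole graph this is equivalent to being well-covered, but it is
   visibly inherited by S :\: cnbh v. *)
Definition well_covered_in S : Prop := forall X Y, X \subset S -> Y \subset S ->
  independent X -> independent Y -> {in S, forall z, dominates X z -> dominates Y z} ->
  #|X| <= #|Y|.

(** Extend Y to a maximal independent set D. Whatever X dominates, Y dominates, so X together with D
    - Y is still independent and disjoint; by well-coveredness |X| + |D - Y| <= |D|. *)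
Lemma well_covered_inT : well_covered G -> well_covered_in [set: G].
Proof.
move=> wc X Y _ _ iX iY dXY.
have [D maxD YD] := maxset_exists iY.
have iD := maxsetp maxD.
have iXD : independent (X :|: (D :\: Y)).
  have nXD x d : x \in X -> d \in D :\: Y -> ~~ adj x d.
    move=> xX; rewrite inE => /andP[dY dD]; apply/negP => xd.
    have /dXY : dominates X d by apply/dominatesP; exists x; rewrite ?xd ?orbT.
    rewrite inE => /(_ isT) /dominatesP[y yY /predU1P[e|yd]]; first by rewrite e yY in dY.
    by have := indepP _ iD y d (subsetP YD _ yY) dD; rewrite yd.
  apply/indepP => x y; rewrite [x \in _]inE [y \in _]inE => /orP[xX|xD] /orP[yX|yD].
  - exact: (indepP _ iX).
  - exact: nXD.
  - by rewrite adj_sym nXD.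
  - by apply: (indepP _ iD); [move: xD|move: yD]; rewrite inE => /andP[].
have dis : [disjoint X & D :\: Y].
  apply/pred0P => d /=; rewrite in_setD; apply/and3P => -[dX dY dD].
  have /dXY : dominates X d by apply/dominatesP; exists d; rewrite ?eqxx.
  rewrite inE => /(_ isT) /dominatesP[y yY /predU1P[e|yd]]; first by rewrite e yY in dY.
  by have := indepP _ iD y d (subsetP YD _ yY) dD; rewrite yd.
have [D' maxD' XD'] := maxset_exists iXD.
have := subset_leq_card XD'; rewrite (wc _ _ maxD' maxD).
rewrite cardsU (disjoint_setI0 dis) cards0 subn0 -(cardsID Y D) (setIidPr YD).
by rewrite leq_add2r.
Qed.

(** Adding v to both sets keeps them independent and takes care of domination inside the removed
    neighbourhood. *)
Lemma well_covered_inD S v : v \in S -> well_covered_in S -> well_covered_in (S :\: cnbh v).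
Proof.
move=> vS wc X Y XS YS iX iY dXY.
have nv (Z : {set G}) z : Z \subset S :\: cnbh v -> z \in Z -> [/\ z \in S, z != v & ~~ adj v z].
  by move=> ZS /(subsetP ZS); rewrite !inE negb_or => /andP[/andP[-> ->] ->].
have vN (Z : {set G}) : Z \subset S :\: cnbh v -> v \notin Z.
  by move=> ZS; apply/negP => /(nv _ _ ZS)[_]; rewrite eqxx.
have iv (Z : {set G}) : Z \subset S :\: cnbh v -> independent Z -> independent (v |: Z).
  by move=> ZS iZ; rewrite indepU1 iZ; apply/forall_inP => z /(nv _ _ ZS)[].
have sv (Z : {set G}) : Z \subset S :\: cnbh v -> v |: Z \subset S.
  by move=> ZS; rewrite subUset sub1set vS; apply: subset_trans ZS (subsetDl _ _).
have := wc (v |: X) (v |: Y) (sv _ XS) (sv _ YS) (iv _ XS iX) (iv _ YS iY).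
rewrite !cardsU1 !vN // leq_add2l; apply=> z zS /dominatesP[x].
rewrite !inE => /predU1P[->|xX] xz; first by apply/dominatesP; exists v; rewrite ?setU11.
case: (boolP (z \in cnbh v)) => [|nz].
  by rewrite inE => h; apply/dominatesP; exists v; rewrite ?setU11.
have /dXY : dominates X z by apply/dominatesP; exists x.
rewrite in_setD nz zS => /(_ isT) /dominatesP[y yY yz].
by apply/dominatesP; exists y; rewrite // inE yY orbT.
Qed.

Definition leaf_at S v u : Prop :=
  [/\ v \in S, u \in S & {in S, forall x, adj v x = (x == u)}].

Lemma leaf_neq S v u : leaf_at S v u -> v != u.
Proof.
by case=> vS uS h; apply/eqP => e; have := h _ uS; rewrite {1}e adj_irr eqxx.
Qed.

Lemma leafD S v u : leaf_at S v u -> S :\: cnbh v = S :\ v :\ u.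
Proof.
case=> vS uS h; apply/setP => x; rewrite !inE negb_or; case xS: (x \in S); last by rewrite !andbF.
by rewrite h // !andbT andbC.
Qed.

Lemma card_leafD S v u : leaf_at S v u -> #|S| = #|S :\ v :\ u|.+2.
Proof.
move=> lf; have [vS uS _] := lf; rewrite (cardsD1 v) vS (cardsD1 u (S :\ v)) !inE uS.
by rewrite eq_sym (leaf_neq lf).
Qed.

Lemma no_twin_leaves S v w u : well_covered_in S -> leaf_at S v u -> leaf_at S w u -> v = w.
Proof.
move=> wc lv lw; have [vS uS hv] := lv; have [wS _ hw] := lw.
apply/eqP/negPn/negP => vw.
(* Both leaves and their closed neighbourhoods lie in that of u, so two vertices would be exchanged
   for one. *)
have := wc [set v; w] [set u].
rewrite cards1 cards2 vw ltnn => h; suff: false by []; apply: h.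
- by rewrite subUset !sub1set vS.
- by rewrite sub1set.
- apply/indepP => x y; rewrite !inE => /orP[]/eqP-> /orP[]/eqP->;
  by rewrite ?adj_irr // ?hv ?hw // ?(leaf_neq lv) ?(leaf_neq lw).
- exact: independent1.
move=> z zS /dominatesP[x xX hz]; apply/dominatesP; exists u; first by rewrite inE.
move: xX hz; rewrite !inE => /orP[]/eqP-> /predU1P[->|].
- by rewrite adj_sym hv // eqxx orbT.
- by rewrite hv // => ->.
- by rewrite adj_sym hw // eqxx orbT.
- by rewrite hw // => ->.
Qed.

(* G is built from C by repeatedly attaching a path a - u - v of two new
   vertices; U collects the vertices u. *)
Inductive grown (C : {set G}) : {set G} -> {set G} -> Prop :=
| Grown0 : grown C C set0
| GrownStep S U a u v : grown C S U -> a \in C :|: U -> u \notin S -> v \notin S ->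
    {in S, forall x, adj u x = (x == a)} -> {in S, forall x, ~~ adj v x} -> adj v u ->
    grown C (u |: (v |: S)) (u |: U).

Lemma grown_sub C S U : grown C S U -> C \subset S.
Proof. by elim=> // {}S {}U a u v _ CS *; apply: subset_trans CS _; rewrite setUA subsetUr. Qed.

Lemma pendant_pair_leaf S u v : u \notin S -> v \notin S ->
    {in S, forall x, ~~ adj v x} -> adj v u ->
  leaf_at (u |: (v |: S)) v u /\ (u |: (v |: S)) :\ v :\ u = S.
Proof.
move=> uS vS hv vu; have nvu : v != u by apply: contraTneq vu => ->; rewrite adj_irr.
split; first split; rewrite ?inE ?eqxx ?orbT //.
  move=> x; rewrite !inE => /or3P[/eqP->|/eqP->|xS]; rewrite ?vu ?eqxx // ?adj_irr.
    by rewrite (negbTE nvu).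
  by rewrite (negbTE (hv _ xS)); apply/esym; apply: contraNF uS => /eqP<-.
apply/setP => x; rewrite !inE; case: (eqVneq x u) => [->|_]; first by rewrite (negbTE uS).
by case: (eqVneq x v) => [->|_] //=; rewrite (negbTE vS).
Qed.

Lemma grown_well_covered C S U : grown C S U -> well_covered_in S -> well_covered_in C.
Proof.
elim=> // {}S {}U a u v gS IH _ uS vS _ hv vu wc; apply: IH.
have [lf <-] := pendant_pair_leaf uS vS hv vu.
by rewrite -(leafD lf); apply: well_covered_inD => //; case: lf.
Qed.

(** [m] sends each vertex of U to its leaf. The last clause, a neighbour of u other than its leaf,
    provides the vertex b of [attach_not_leaf]. *)
Lemma grown_leaves C S U : grown C S U -> exists m : G -> G,
  [/\ [disjoint C & U], S = C :|: U :|: m @: U, {in U, forall u, m u \notin C :|: U},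
      {in U & S, forall u x, adj (m u) x = (x == u)} &
      {in U, forall u, exists2 b, b \in S & (b != m u) && adj u b}].
Proof.
elim=> {S U} [|S U a u v gS [m [dis eS mN madj mb]] aCU uS vS hu hv vu].
  exists id; split=> [||x|x|x]; rewrite ?inE //.
    by rewrite -setI_eq0 setI0.
  by rewrite imset0 !setU0.
have [[_ _ lf] _] := pendant_pair_leaf uS vS hv vu.
have nvu : v != u by apply: contraTneq vu => ->; rewrite adj_irr.
have CUS : C :|: U \subset S by rewrite eS subsetUl.
have uU : u \notin U by apply: contraNN uS => uU; apply: (subsetP CUS); rewrite inE uU orbT.
have uC : u \notin C by apply: contraNN uS => uC; apply: (subsetP CUS); rewrite inE uC.
pose m' x := if x == u then v else m x.
have m'u : m' u = v by rewrite /m' eqxx.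
have m'U x : x \in U -> m' x = m x by rewrite /m'; case: eqP => // ->; rewrite (negbTE uU).
have mS x : x \in U -> m x \in S by move=> xU; rewrite eS inE imset_f ?orbT.
have aS : a \in S by apply: (subsetP CUS).
exists m'; split.
- rewrite -setI_eq0 setIUr setU_eq0 !setI_eq0 dis andbT.
  by rewrite disjoint_sym disjoints1.
- have -> : m' @: (u |: U) = v |: m @: U.
    by rewrite imsetU1 m'u; congr (_ |: _); apply: eq_in_imset.
  by rewrite eS; apply/setP => x; rewrite !inE; do !case: (_ \in _); do !case: (_ == _).
- move=> x; rewrite !inE => /predU1P[->|xU].
    rewrite m'u (negbTE nvu) /=; apply: contraNN vS => h; apply: (subsetP CUS).
    by rewrite inE.
  rewrite m'U //; have := mN x xU; rewrite inE !negb_or => /andP[-> ->].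
  by rewrite andbT; apply: contraNneq uS => <-; apply: mS.
- move=> x y; rewrite !inE => /predU1P[->|xU]; first by rewrite m'u => yS; apply: lf; rewrite !inE.
  rewrite m'U // => /or3P[/eqP->|/eqP->|yS]; last exact: madj.
    rewrite adj_sym hu ?mS //; have -> : (u == x) = false.
      by apply: contraNF uU => /eqP->.
    by apply: contraNF (mN x xU) => /eqP->.
  rewrite adj_sym (negbTE (hv _ (mS _ xU))); apply/esym; apply: contraNF vS => /eqP->.
  by apply: (subsetP CUS); rewrite inE xU orbT.
- move=> x; rewrite in_setU1 => /predU1P[->|xU].
    exists a; first by rewrite !inE aS !orbT.
    by rewrite m'u hu // eqxx andbT; apply: contraNneq vS => <-.
  have [b bS h] := mb x xU; exists b; first by rewrite !inE bS !orbT.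
  by rewrite m'U.
Qed.

End WellCovered.

(** * Peeling pendant paths down to the cycle *)

Section Classification.
Variables (G : sgraph) (c : seq G).
Hypothesis c_cycle : is_cycle c.
Hypothesis c_unique : forall c', is_cycle c' -> c' =i c.
Implicit Types (u v w x y z a b : G) (A S U X Y : {set G}).

Let C : {set G} := [set x in c].

(** Connectivity stated through cuts around C, a form that is easily passed on when a pendant pair
    is deleted. *)
Definition connected_in S : Prop := forall A, C \subset A -> A \subset S -> A != S ->
  exists2 x, x \in A & exists2 y, y \in S :\: A & adj x y.

Lemma connected_inT : connected G -> connected_in [set: G].
Proof.
case=> _ conn A CA _ nA.
have [x xC] : exists x, x \in C.
  by move: c_cycle; rewrite /C; case: (c) => // x s _; exists x; rewrite !inE eqxx.
have xA := subsetP CA _ xC.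
have [y yA] : exists y, y \notin A.
  by apply/existsP; rewrite -negb_forall; apply: contra nA => /forallP h; apply/eqP/setP => y; rewrite inE h.
case: (boolP [exists x in A, [exists y in [set: G] :\: A, adj x y]]).
  by case/exists_inP=> x' x'A /exists_inP[y' y'A h]; exists x' => //; exists y'.
rewrite negb_exists_in => /forall_inP nadj; exfalso.
have cl : closed adj A.
  apply: intro_closed; first exact/sym_connect_sym/adj_sym.
  move=> x' y' xy x'A; apply/negPn/negP => y'A.
  by have /exists_inP := nadj x' x'A; case; exists y'; rewrite // !inE y'A.
by move: (closed_connect cl (conn x y)); rewrite xA (negbTE yA).
Qed.

(** S is acyclic, so a leaf and its neighbour u can be removed repeatedly, two vertices at a time. A
    vertex isolated by such a removal but not before would be a second leaf at u. *)
Lemma odd_isolated S : well_covered_in S -> odd #|S| -> ~~ (C \subset S) ->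
  exists2 w, w \in S & {in S, forall x, ~~ adj w x}.
Proof.
have [n] := ubnP #|S|; elim: n S => // n IH S leS wc oS nC.
have Sn0 : S != set0 by apply: contraTneq oS => ->; rewrite cards0.
have [z zS hz] := acyclic_low_degree Sn0 (acyclicN c_unique nC).
case: (boolP [exists u in S, adj z u]) => [/exists_inP[u uS zu]|]; last first.
  by rewrite negb_exists_in => /forall_inP h; exists z.
have lz : leaf_at S z u.
  split=> // x xS; apply/idP/eqP => [zx|->//]; exact: hz.
have cS := card_leafD lz; move: leS oS; rewrite cS /= negbK => leS oS.
have wc' : well_covered_in (S :\ z :\ u) by rewrite -(leafD lz); apply: well_covered_inD.
have nC' : ~~ (C \subset S :\ z :\ u).
  by apply: contra nC => CS; apply: subset_trans CS (subset_trans (subsetDl _ _) (subsetDl _ _)).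
have [w wS hw] := IH (S :\ z :\ u) (ltnW leS) wc' oS nC'.
move: wS; rewrite !inE => /and3P[wu wz wS].
have hw' x : x \in S -> adj w x -> x = u.
  move=> xS; apply: contraTeq => xu; case: (eqVneq x z) => [->|xz].
    by rewrite adj_sym; case: lz => _ _ ->.
  by apply: hw; rewrite !inE xu xz.
case: (boolP (adj w u)) => wu'; last first.
  by exists w => // x xS; apply: contraNN wu' => wx; rewrite -(hw' x).
exfalso; move/eqP: wz; apply; apply/esym; apply: (no_twin_leaves wc lz).
by split=> // x xS; apply/idP/eqP => [/hw'->|->].
Qed.

Lemma cycle_vertex_adj x : x \in C -> exists2 y, y \in C & adj x y.
Proof.
rewrite inE => xc; have /and3P[_ cyc _] : [&& 2 < size c, cycle adj c & uniq c] by move: c_cycle.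
by exists (next c x); [rewrite inE mem_next|apply: next_cycle].
Qed.

(** Here parity protects the cycle: if u were on C, removing v and u would leave an acyclic set of
    odd order, hence an isolated vertex, which in S is a second leaf at u. *)
Lemma leaf_outside_cycle S v u : C \subset S -> well_covered_in S -> odd #|S| ->
    {in S, forall x, exists2 y, y \in S & adj x y} -> leaf_at S v u ->
  (v \notin C) /\ (u \notin C).
Proof.
move=> CS wc oS noiso lf; have uC : u \notin C.
  apply/negP => uC.
  have wc' : well_covered_in (S :\ v :\ u) by rewrite -(leafD lf); apply: well_covered_inD => //; case: lf.
  have [||w wS hw] := odd_isolated wc'.
  - by move: oS; rewrite (card_leafD lf) /= negbK.
  - by apply/negP => /subsetP/(_ _ uC); rewrite !inE eqxx.
  move: wS; rewrite !inE => /and3P[wu wv wS].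
  have hw' x : x \in S -> adj w x -> x = u.
    move=> xS; apply: contraTeq => xu; case: (eqVneq x v) => [->|xv].
      by rewrite adj_sym; case: lf => _ _ ->.
    by apply: hw; rewrite !inE xu xv.
  have [y yS wy] := noiso w wS; have ey := hw' y yS wy; rewrite ey in wy.
  move/eqP: wv; apply; apply/esym; apply: (no_twin_leaves wc lf).
  by split=> //; [case: lf|move=> x xS; apply/idP/eqP => [/hw'->|->]].
split=> //; apply/negP => /cycle_vertex_adj[y yC vy]; move: uC.
by case: lf => _ _ h; move: vy; rewrite h ?(subsetP CS) // => /eqP<-; rewrite yC.
Qed.

Lemma attach_not_leaf S v u a U : grown C (S :\ v :\ u) U -> well_covered_in S ->
    leaf_at S v u -> a \in S :\ v :\ u -> {in S :\ v :\ u, forall x, adj u x = (x == a)} ->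
  a \in C :|: U.
Proof.
move=> gS wc lf aS hu; apply/negPn/negP => aCU.
have [vS uS hv] := lf.
have [m [_ eS mN madj mb]] := grown_leaves gS.
set S2 := S :\ v :\ u in gS aS hu eS madj mb.
have /imsetP[u' u'U ea] : a \in m @: U by move: aS; rewrite eS inE (negbTE aCU).
have [b bS /andP[nb u'b]] := mb u' u'U.
have inS2 x : x \in S2 -> [/\ x \in S, x != v & x != u].
  by rewrite !inE => /and3P[-> -> ->].
have [aS' av au] := inS2 _ aS; have [bS' bv bu] := inS2 _ bS.
have ba : b != a by rewrite ea.
have aadj x : x \in S2 -> adj a x = (x == u') by move=> xS; rewrite ea madj.
have nab : ~~ adj a b.
  by rewrite aadj //; apply: contraTneq u'b => ->; rewrite adj_irr.
have nbu : ~~ adj u b by rewrite hu.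
(* Here a is the leaf of u', and b another neighbour of u'. The neighbours of a are u', dominated by
   b, and u; the only neighbour of v is u. So three vertices would be exchanged for two. *)
have := wc (b |: (a |: [set v])) (b |: [set u]).
have -> : #|b |: (a |: [set v])| = 3.
  by rewrite !cardsU1 cards1 !inE negb_or ba bv av.
have -> : #|b |: [set u]| = 2 by rewrite cardsU1 cards1 inE bu.
move=> h; suff: false by []; apply: h.
- by rewrite !subUset !sub1set bS' aS' vS.
- by rewrite !subUset !sub1set bS' uS.
- rewrite !indepU1; apply/andP; split; [apply/andP; split|].
  + exact: independent1.
  + by apply/forall_inP => x; rewrite !inE => /eqP->; rewrite adj_sym hv.
  + apply/forall_inP => x; rewrite !inE => /orP[]/eqP->; first by rewrite adj_sym.
    by rewrite adj_sym hv.
- rewrite indepU1; apply/andP; split.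
    exact: independent1.
  by apply/forall_inP => x; rewrite !inE => /eqP->; rewrite adj_sym.
move=> z zS /dominatesP[x]; rewrite !inE => /or3P[]/eqP-> hz.
- by apply/dominatesP; exists b; rewrite ?inE ?eqxx.
- case: (eqVneq z u) => [->|zu]; first by apply/dominatesP; exists u; rewrite ?inE ?eqxx ?orbT.
  case: (eqVneq z v) hz => [->|zv] hz.
    by move: hz; rewrite eq_sym (negbTE av) adj_sym hv //= (negbTE au).
  have zS2 : z \in S2 by rewrite !inE zu zv.
  case/predU1P: hz => [->|].
    by apply/dominatesP; exists u; rewrite ?inE ?eqxx ?orbT // hu // eqxx orbT.
  rewrite aadj // => /eqP->; apply/dominatesP; exists b; rewrite ?inE ?eqxx //.
  by rewrite adj_sym u'b orbT.
- apply/dominatesP; exists u; rewrite ?inE ?eqxx ?orbT //.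
  case/predU1P: hz => [->|]; last by rewrite hv // => ->.
  by rewrite adj_sym hv // eqxx orbT.
Qed.

Lemma well_covered_grown S : C \subset S -> well_covered_in S -> odd #|S| -> connected_in S ->
  exists U, grown C S U.
Proof.
have [n] := ubnP #|S|; elim: n S => // n IH S leS CS wc oS conn.
case: (eqVneq S C) => [->|nSC]; first by exists set0; apply: Grown0.
have noiso : {in S, forall x, exists2 y, y \in S & adj x y}.
  move=> x xS; case: (boolP (x \in C)) => [/cycle_vertex_adj[y yC xy]|xC].
    by exists y => //; apply: (subsetP CS).
  have [||| y yS [z zS yz]] := conn (S :\ x).
  - by rewrite subsetD1 CS.
  - exact: subsetDl.
  - by apply/eqP => /setP/(_ x); rewrite !inE eqxx xS.
  move: yS zS; rewrite !inE negb_and negbK => /andP[yx yS] /andP[/orP[/eqP ez|nz] zS].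
    by exists y => //; rewrite adj_sym -ez.
  by rewrite zS in nz.
pose leaf x := [exists u in S, adj x u && [forall w in S, adj x w ==> (w == u)]].
have leafP x : x \in S -> leaf x -> exists u, leaf_at S x u.
  move=> xS /exists_inP[u uS /andP[xu /forall_inP h]]; exists u; split=> // w wS.
  by apply/idP/eqP => [xw|->//]; apply/eqP; have := h w wS; rewrite xw.
have leaf_leaf x u : leaf_at S x u -> leaf x.
  case=> xS uS h; apply/exists_inP; exists u => //; rewrite h // eqxx /=.
  by apply/forall_inP => w wS; rewrite h // implybb.
have low_leaf x : x \in S -> {in S &, forall y y', adj x y -> adj x y' -> y = y'} -> leaf x.
  move=> xS h; have [y yS xy] := noiso x xS; apply/exists_inP; exists y; rewrite // xy.
  by apply/forall_inP => w wS; apply/implyP => xw; apply/eqP; apply: h.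
(* A vertex that becomes a leaf after all leaves are deleted will be the middle vertex u of a
   pendant path. *)
pose S' := [set x in S | ~~ leaf x].
have CS' : C \subset S'.
  apply/subsetP => x xC; rewrite inE (subsetP CS) //=; apply/negP => lx.
  have [u lf] := leafP x (subsetP CS _ xC) lx.
  by have [] := leaf_outside_cycle CS wc oS noiso lf; rewrite xC.
(* Otherwise a leaf outside C has a neighbour outside C that is a leaf as well, and the two are cut
   off from C. *)
have nS'C : S' != C.
  apply/eqP => eS'; have [z zSC hz] := low_degree_outside c_cycle c_unique CS nSC.
  move: zSC; rewrite inE => /andP[zC zS].
  have lz := low_leaf z zS hz; have [u lf] := leafP z zS lz.
  have [_ uC] := leaf_outside_cycle CS wc oS noiso lf.
  have [_ uS hzu] := lf.
  have lu : leaf u.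
    case: (boolP (leaf u)) => [//|nlu]; case/negP: uC.
    by rewrite -eS' inE uS.
  have [w lfu] := leafP u uS lu; have [_ wS huw] := lfu.
  have ew : w = z by apply/esym/eqP; rewrite -huw // adj_sym hzu.
  have [||| x xS [y yS xy]] := conn (S :\ z :\ u).
  - by rewrite !subsetD1 CS zC uC.
  - by apply: subset_trans (subsetDl _ _) (subsetDl _ _).
  - by apply/eqP => /setP/(_ z); rewrite !inE eqxx zS /= andbF.
  move: xS yS xy; rewrite !inE => /and3P[xu xz xS] /andP[]; rewrite !negb_and !negbK.
  case/or3P => [/eqP->|/eqP->|/negP//] _; rewrite adj_sym.
    by rewrite huw // ew (negbTE xz).
  by rewrite hzu // (negbTE xu).
have [u] := low_degree_outside c_cycle c_unique CS' nS'C.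
rewrite !inE => /andP[uC /andP[uS nlu]] hu.
(* Without a leaf next to it, u would have its low degree already in S and be a leaf there. *)
have [v vS /andP[lv uv]] : exists2 v, v \in S & leaf v && adj u v.
  apply/exists_inP; rewrite -[X in is_true X]negbK negb_exists_in; apply/negP => /forall_inP h.
  move/negP: nlu; apply; apply: low_leaf => // y y' yS y'S uy uy'; apply: hu => //.
    by rewrite inE yS; have := h y yS; rewrite uy andbT.
  by rewrite inE y'S; have := h y' y'S; rewrite uy' andbT.
have lf : leaf_at S v u.
  have [w lf] := leafP v vS lv; have [_ wS hw] := lf.
  by have := hw u uS; rewrite adj_sym uv => /esym/eqP ->.
have [_ _ hv] := lf.
have [vC _] := leaf_outside_cycle CS wc oS noiso lf.
set S2 := S :\ v :\ u.
have inS2 x : (x \in S2) = [&& x != u, x != v & x \in S] by rewrite !inE.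
have CS2 : C \subset S2 by rewrite !subsetD1 CS vC inE.
have S2S : S2 \subset S by apply: subset_trans (subsetDl _ _) (subsetDl _ _).
have [a aS ua] : exists2 a, a \in S2 & adj u a.
  have [|x xS [y yS xy]] := conn S2 CS2 S2S.
    by apply/eqP => /setP/(_ u); rewrite inS2 eqxx uS.
  exists x => //; move: yS xy; rewrite in_setD inS2 !negb_and !negbK => /andP[].
  move: xS; rewrite inS2 => /and3P[xu xv xS].
  case/or3P => [/eqP->|/eqP->|/negP//] _; rewrite adj_sym //.
  by rewrite hv // (negbTE xu).
(* By [no_twin_leaves], v is the only leaf at u, so the other neighbours of u lie in S', where u has
   at most one. *)
have hua : {in S2, forall x, adj u x = (x == a)}.
  have nl x : x \in S2 -> adj u x -> x \in S'.
    rewrite inS2 => /and3P[xu xv xS] ux; rewrite inE xS; apply/negP => lx.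
    have [w lfx] := leafP x xS lx; have [_ wS hx] := lfx.
    have ew : w = u by have := hx u uS; rewrite adj_sym ux => /esym/eqP.
    by move/eqP: xv; apply; apply: (no_twin_leaves wc _ lf); rewrite -ew.
  by move=> x xS; apply/idP/eqP => [ux|->//]; apply: hu => //; apply: nl.
have cS := card_leafD lf.
have wc2 : well_covered_in S2 by rewrite /S2 -(leafD lf); apply: well_covered_inD.
have lt2 : #|S2| < n by move: leS; rewrite cS ltnS => /ltnW.
have oS2 : odd #|S2| by move: oS; rewrite cS /= negbK.
have conn2 : connected_in S2.
  move=> A CA AS nA.
  (* When A contains a, adding the pair u, v prevents the leaving edge from being a - u; otherwise
     no edge joins A to the pair. *)
  pose A' := if a \in A then u |: (v |: A) else A.
  have AA' : A \subset A' by rewrite /A'; case: ifP => // _; rewrite setUA subsetUr.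
  have [||| x xA [y yS xy]] := conn A'.
  + exact: subset_trans CA AA'.
  + rewrite /A'; case: ifP => _; last exact: subset_trans AS S2S.
    by rewrite !subUset !sub1set uS vS; apply: subset_trans AS S2S.
  + apply/eqP => eA'; move/eqP: nA; apply; apply/eqP; rewrite eqEsubset AS.
    apply/subsetP => x xS2; have : x \in A' by rewrite eA' (subsetP S2S).
    rewrite /A'; case: ifP => // _; rewrite !inE.
    by move: xS2; rewrite inS2 => /and3P[/negbTE-> /negbTE->].
  have inA x' : x' \in A -> [/\ x' \in S, x' != u & x' != v].
    by move/(subsetP AS); rewrite inS2 => /and3P[-> -> ->].
  move: xA yS xy; rewrite in_setD /A'; case: ifP => aA.
    rewrite !inE !negb_or => /or3P[/eqP->|/eqP->|xA] /andP[/and3P[yu yv yA] yS].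
    * by rewrite hua ?inS2 ?yu ?yv // => /eqP ey; rewrite ey aA in yA.
    * by rewrite hv // (negbTE yu).
    * by exists x => //; exists y; rewrite // in_setD yA inS2 yu yv.
  move=> xA /andP[yA yS] xy; have [xS xu xv] := inA x xA.
  exists x => //; exists y => //; rewrite in_setD yA inS2 yS andbT /=; apply/andP; split.
    apply: contraTneq xy => ->; rewrite adj_sym hua ?inS2 ?xu ?xv //.
    by apply: contraFneq aA => <-.
  by apply: contraTneq xy => ->; rewrite adj_sym hv.
have [U gU] := IH S2 lt2 CS2 wc2 oS2 conn2.
have aCU := attach_not_leaf gU wc lf aS hua.
exists (u |: U).
have -> : S = u |: (v |: S2).
  by apply/setP => x; rewrite !inE; case: eqP => [->|_] //=; case: eqP => [->|].
apply: GrownStep gU aCU _ _ hua _ _.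
- by rewrite inS2 eqxx.
- by rewrite inS2 eqxx andbF.
- by move=> x; rewrite inS2 => /and3P[/negbTE xu _ xS]; rewrite hv // xu.
- by rewrite hv ?eqxx.
Qed.

End Classification.

(** * Reduction to trees *)

Section Transfer.
Local Open Scope ring_scope.
Variables (K : fieldType) (G : sgraph) (x : K).
Hypothesis x1 : 1 + x != 0.
Implicit Types (v : G) (A B L W C U P Q : {set G}).

Let y := x / (1 + x).

(* The part of L still available once the independent set B has been chosen. *)
Definition beyond L B : {set G} := [set z in L | [forall b in B, ~~ adj b z]].

Lemma beyond0 L : beyond L set0 = L.
Proof. by apply/setP => z; rewrite inE; case: (z \in L) => //=; apply/forall_inP => b; rewrite inE. Qed.

Lemma beyondU1 L B v : beyond L (v |: B) = beyond (beyond L [set v]) B.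
Proof.
apply/setP => z; rewrite !inE -andbA; congr (_ && _); apply/forall_inP/andP => [h|[/forall_inP h1 /forall_inP h2] b].
  split; apply/forall_inP => b; rewrite ?inE => bB; apply: h; rewrite !inE ?bB ?orbT //.
by rewrite !inE => /predU1P[->|/h2//]; apply: h1; rewrite inE.
Qed.

(** Both sides are sums over the independent B inside A, with x^|B| = y^|B| (1 + x)^|B|; the
    hypothesis compares them term by term. In the induction, choosing v divides [q] by 1 + x. *)
Lemma ieval_transfer A L W q : [disjoint A & L] -> [disjoint A & W] ->
    (forall B, B \subset A -> independent B ->
       ieval (beyond L B) x * (1 + x) ^+ #|B| = q * ieval (beyond W B) y) ->
  ieval (A :|: L) x = q * ieval (A :|: W) y.
Proof.
have [n] := ubnP #|A|; elim: n A L W q => // n IH A L W q leA AL AW h.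
case: (set_0Vmem A) => [eA|[v vA]].
  have := h set0 (sub0set _) (indep0 G).
  by rewrite !beyond0 cards0 mulr1 eA !set0U.
have split (S : {set G}) (AS : [disjoint A & S]) (z : K) : ieval (A :|: S) z =
    ieval (A :\ v :|: S) z + z * ieval ((A :\: cnbh v) :|: beyond S [set v]) z.
  have vAS : v \in A :|: S by rewrite inE vA.
  have vS : v \notin S by rewrite (disjointFr AS).
  rewrite (ieval_rec _ vAS); congr (_ + _ * _); congr (ieval _ _); apply/setP => w; rewrite !inE.
    by case: (eqVneq w v) => [->|]; rewrite // (negbTE vS).
  rewrite negb_or; case wS: (w \in S); last by rewrite !orbF.
  rewrite !orbT andbT (disjointFl AS wS) andbF /=.
  have -> : (w != v) by apply: contraNneq vS => <-.
  by apply/idP/forall_inP => [vw b|]; [rewrite inE => /eqP->|apply; rewrite inE].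
have ltv (C : {set G}) : v \notin C -> C \subset A -> (#|C| < n)%N.
  move=> vC CA; have /proper_card lt : C \proper A by apply/properP; split=> //; exists v.
  exact: leq_trans lt leA.
rewrite (split L AL) (split W AW).
rewrite (IH (A :\ v) L W q); first last.
- by move=> B BA; apply: h; apply: subset_trans BA (subsetDl _ _).
- by apply: disjointWl AW; apply: subsetDl.
- by apply: disjointWl AL; apply: subsetDl.
- by apply: ltv; rewrite ?subsetDl // !inE eqxx.
rewrite (IH (A :\: cnbh v) (beyond L [set v]) (beyond W [set v]) (q / (1 + x))); first last.
- move=> B BA iB; rewrite -!beyondU1; apply: (mulIf x1).
  have vB : v \notin B by apply/negP => /(subsetP BA); rewrite !inE eqxx.
  have := h (v |: B); rewrite cardsU1 vB add1n exprSr mulrA => -> //.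
  + by field.
  + by rewrite subUset sub1set vA (subset_trans BA) // subsetDl.
  rewrite indepU1 iB; apply/forall_inP => b /(subsetP BA).
  by rewrite !inE negb_or => /andP[/andP[]].
- apply: disjointWl (subsetDl _ _) _; apply: disjointWr AW.
  by apply/subsetP => w; rewrite inE => /andP[].
- apply: disjointWl (subsetDl _ _) _; apply: disjointWr AL.
  by apply/subsetP => w; rewrite inE => /andP[].
- by apply: ltv; rewrite ?subsetDl // !inE eqxx.
by rewrite /y; field.
Qed.

Definition matched C U (m : G -> G) : Prop :=
  [/\ [disjoint C & U], [set: G] = C :|: U :|: m @: U,
      {in U, forall u, m u \notin C :|: U} &
      {in U, forall u x, adj (m u) x = (x == u)}].

Lemma matched_inj C U m : matched C U m -> {in U &, injective m}.
Proof.
case=> _ _ _ madj u u' uU u'U e; apply/eqP.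
by rewrite -(madj u' u'U) -e madj // eqxx.
Qed.

Lemma card_matched C U m : matched C U m -> #|G| = (#|C| + #|U|.*2)%N.
Proof.
move=> mat; have [CU eT mN _] := mat.
rewrite -cardsT eT cardsU disjoint_setI0; last first.
  apply/pred0P => z /=; apply/negP => /andP[zCU /imsetP[u uU ez]].
  by have := mN u uU; rewrite -ez zCU.
rewrite cards0 subn0 cardsU (disjoint_setI0 CU) cards0 subn0.
by rewrite card_in_imset ?addnn -?addnA ?addnn //; exact: matched_inj mat.
Qed.

(** Given B, the leaves of U - B remain free and contribute (1 + x)^|U - B|, which the factor (1 +
    x)^|U & B| completes to (1 + x)^|U|. P collects the cycle vertices to be summed out, W those of
    them that are kept in the tree. *)
Lemma ieval_matched C U m P Q W q : matched C U m -> C = Q :|: P -> [disjoint Q & P] ->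
    W \subset P -> {in U & P, forall u p, ~~ adj u p} ->
    (forall B, B \subset Q -> independent B ->
       ieval (beyond P B) x * (1 + x) ^+ #|B| = q * ieval (beyond W B) y) ->
  ieval [set: G] x = (1 + x) ^+ #|U| * q * ieval (U :|: Q :|: W) y.
Proof.
move=> mat eC QP WP UP h; have [CU eT mN madj] := mat; have minj := matched_inj mat.
have QC : Q \subset C by rewrite eC subsetUl.
have PC : P \subset C by rewrite eC subsetUr.
have PU : [disjoint P & U] by apply: disjointWl CU.
have mUP : [disjoint m @: U & P].
  apply/pred0P => z /=; apply/negP => /andP[/imsetP[u uU ->] mP].
  by have := mN u uU; rewrite inE (subsetP PC).
have -> : [set: G] = (U :|: Q) :|: (m @: U :|: P).
  by rewrite eT eC; apply/setP => z; rewrite !inE; do !case: (_ \in _).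
apply: ieval_transfer.
- apply/pred0P => z /=; apply/negP; rewrite !inE => /andP[zA] /orP[/imsetP[u uU ez]|zP].
    have := mN u uU; rewrite -ez inE negb_or => /andP[zC zU].
    by move: zA; rewrite (negbTE zU) /= => /(subsetP QC); rewrite (negbTE zC).
  by move: zA; rewrite (disjointFr PU zP) (disjointFl QP zP).
- apply: disjointWr WP _; apply/pred0P => z /=; apply/negP; rewrite !inE => /andP[zA zP].
  by move: zA; rewrite (disjointFr PU zP) (disjointFl QP zP).
move=> B BA iB.
have iBQ : independent (B :&: Q) by apply: indepS iB; apply: subsetIl.
have beyondQ (S : {set G}) : S \subset P -> beyond S B = beyond S (B :&: Q).
  move=> SP; apply/setP => z; rewrite !inE; case zS: (z \in S) => //=.
  apply/forall_inP/forall_inP => [hz b|hz b bB]; first by rewrite inE => /andP[/hz].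
  have := subsetP BA _ bB; rewrite inE => /orP[bU|bQ].
    by apply: UP => //; apply: (subsetP SP).
  by apply: hz; rewrite inE bB.
have eL : beyond (m @: U :|: P) B = m @: (U :\: B) :|: beyond P (B :&: Q).
  rewrite -beyondQ //; apply/setP => z; rewrite !inE.
  case zP: (z \in P).
    rewrite orbT /= (_ : (z \in m @: (U :\: B)) = false) //.
    apply/negP => /imsetP[u]; rewrite inE => /andP[_ uU] ez.
    by have := disjointFl mUP zP; rewrite ez imset_f.
  rewrite !orbF; apply/andP/imsetP => [[/imsetP[u uU ez] /forall_inP hz]|[u]].
    exists u => //; rewrite inE uU andbT; apply/negP => uB.
    by have := hz u uB; rewrite ez adj_sym madj ?eqxx.
  rewrite inE => /andP[uB uU] ez; split; first by rewrite ez imset_f.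
  apply/forall_inP => b bB; rewrite ez adj_sym madj //.
  by apply: contraNneq uB => <-.
have cB : #|B| = (#|U :&: B| + #|B :&: Q|)%N.
  have eB : (U :&: B) :|: (B :&: Q) = B.
    apply/setP => z; rewrite !inE; case zB: (z \in B) => //=; last by rewrite andbF.
    by have := subsetP BA _ zB; rewrite inE andbT.
  rewrite -{1}eB cardsU [_ :&: _ :&: _](_ : _ = set0) ?cards0 ?subn0 //.
  apply/setP => z; rewrite !inE; case zQ: (z \in Q); last by rewrite !andbF.
  by rewrite (disjointFr CU (subsetP QC _ zQ)).
rewrite eL ieval_disjoint; first last.
- move=> a b /imsetP[u]; rewrite inE => /andP[_ uU] ->; rewrite inE => /andP[bP _].
  by rewrite madj //; apply: contraTneq bP => ->; rewrite (disjointFl PU).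
- apply: disjointWl (imsetS m (subsetDl _ _)) _; apply: disjointWr mUP.
  by apply/subsetP => w; rewrite inE => /andP[].
rewrite ieval_indep; last first.
  apply/indepP => a b /imsetP[u]; rewrite inE => /andP[_ uU] -> /imsetP[u'].
  rewrite inE => /andP[_ u'U] ->; rewrite madj //; apply: contraNneq (mN u' u'U) => ->.
  by rewrite inE uU orbT.
rewrite card_in_imset; last by move=> a b; rewrite !inE => /andP[_ aU] /andP[_ bU]; apply: minj.
rewrite (beyondQ W WP) -[RHS]mulrA -(h _ (subsetIr _ _) iBQ) cB exprD -(cardsID B U) exprD.
ring.
Qed.

(** At most one of the adjacent a1, a2 is chosen, so a3 behaves as a leaf of either; the factor is 1
    + x in every case. *)
Lemma ieval_tri C U m a1 a2 a3 : matched C U m -> C = [set a1; a2] :|: [set a3] ->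
    a1 != a3 -> a2 != a3 -> adj a1 a2 -> adj a1 a3 -> adj a2 a3 ->
    {in U, forall u, ~~ adj u a3} ->
  ieval [set: G] x = (1 + x) ^+ #|U|.+1 * ieval (U :|: [set a1; a2]) y.
Proof.
move=> mat eC n13 n23 e12 e13 e23 Ua3.
rewrite -[X in ieval X y]setU0 exprSr; apply: (ieval_matched mat eC); rewrite ?sub0set //.
- by rewrite disjoint_sym disjoints1 !inE negb_or !(eq_sym a3) n13.
- by move=> u p uU; rewrite inE => /eqP->; apply: Ua3.
move=> B BQ iB; have -> : beyond set0 B = set0 by apply/setP => z; rewrite !inE.
rewrite ieval0 mulr1.
case: (set_0Vmem B) => [->|[b bB]].
  rewrite beyond0 cards0 mulr1 ieval_indep ?cards1 //.
  exact: independent1.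
have ba3 : adj b a3 by have := subsetP BQ _ bB; rewrite !inE => /orP[]/eqP->.
have -> : beyond [set a3] B = set0.
  apply/setP => z; rewrite !inE; case: eqP => //= ->.
  by apply/negP => /forall_inP/(_ b bB); rewrite ba3.
have -> : B = [set b].
  apply/setP => z; rewrite inE; apply/idP/eqP => [zB|->//].
  have := indepP _ iB b z bB zB.
  have := subsetP BQ _ bB; have := subsetP BQ _ zB; rewrite !inE.
  by move=> /orP[]/eqP-> /orP[]/eqP->; rewrite ?e12 // adj_sym e12.
by rewrite ieval0 cards1 mul1r.
Qed.

(** The factor is (1 + x)^2. If neither a1 nor a3 is chosen, a2, a4, a5 give (1 + x)(1 + 2 x) = (1 +
    x)^2 (1 + y), as if a2 alone were left with weight y; if one is chosen, a4 or a5 gives 1 + x,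
    and if both are, nothing is left. *)
Lemma ieval_pent C U m a1 a2 a3 a4 a5 : matched C U m ->
    C = [set a1; a3] :|: [set a2; a4; a5] -> uniq [:: a1; a2; a3; a4; a5] ->
    adj a1 a2 -> adj a2 a3 -> adj a3 a4 -> adj a4 a5 -> adj a5 a1 ->
    ~~ adj a1 a3 -> ~~ adj a1 a4 -> ~~ adj a2 a4 -> ~~ adj a2 a5 -> ~~ adj a3 a5 ->
    {in U & [set a2; a4; a5], forall u p, ~~ adj u p} ->
  ieval [set: G] x = (1 + x) ^+ #|U|.+2 * ieval (U :|: [set a1; a3] :|: [set a2]) y.
Proof.
move=> mat eC un e12 e23 e34 e45 e51 n13 n14 n24 n25 n35 UP.
have e54 : adj a5 a4 by rewrite adj_sym.
have e15 : adj a1 a5 by rewrite adj_sym.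
have e32 : adj a3 a2 by rewrite adj_sym.
have exprn2 k : (1 + x) ^+ k.+2 = (1 + x) ^+ k * (1 + x) ^+ 2 by rewrite -exprD addn2.
have := un; rewrite /= !inE !negb_or => /and5P[/and4P[d12 d13 d14 d15] /and3P[d23 d24 d25] /andP[d34 d35] d45 _].
rewrite exprn2; apply: (ieval_matched mat eC) => //.
- rewrite -setI_eq0; apply/eqP/setP => z; rewrite !inE.
  apply/negP => /andP[/orP[]/eqP->]; rewrite ?(negbTE d12) ?(negbTE d14) ?(negbTE d15) ?(negbTE d34) ?(negbTE d35) ?orbF //.
  by rewrite eq_sym (negbTE d23).
- by rewrite sub1set !inE eqxx.
have bey (S B : {set G}) z : z \in beyond S B = (z \in S) && [forall b in B, ~~ adj b z] by rewrite inE.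
move=> B BQ iB.
have Bin z : (z \in B) = ((a1 \in B) && (z == a1)) || ((a3 \in B) && (z == a3)).
  apply/idP/orP => [zB|[]/andP[h /eqP->] //].
  have := subsetP BQ _ zB; rewrite !inE => /orP[]/eqP e; move: zB; rewrite e eqxx andbT => ->; by [left|right].
have forallB z : [forall b in B, ~~ adj b z] =
    ((a1 \in B) ==> ~~ adj a1 z) && ((a3 \in B) ==> ~~ adj a3 z).
  apply/forall_inP/andP => [h|[h1 h3] b].
    by split; apply/implyP; apply: h.
  by rewrite Bin => /orP[]/andP[h /eqP->]; [apply: (implyP h1)|apply: (implyP h3)].
have cB : #|B| = ((a1 \in B) + (a3 \in B))%N.
  rewrite (cardsD1 a1); congr (_ + _)%N; rewrite (cardsD1 a3) !inE eq_sym d13 /=.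
  rewrite [B :\ a1 :\ a3](_ : _ = set0) ?cards0 ?addn0 //.
  by apply/setP => z; rewrite !inE [z \in B]Bin; do 2!case: eqP => _; rewrite ?andbF.
have y1 : 1 + y = (1 + x + x) / (1 + x) by rewrite /y; field.
have e2 : ieval [set a2; a4; a5] x = (1 + x) * (1 + x + x).
  rewrite -setUA ieval_disjoint; first last.
  - by move=> a b; rewrite !inE => /eqP-> /orP[]/eqP->.
  - by rewrite disjoints1 !inE negb_or d24.
  rewrite ieval_set1; congr (_ * _).
  have h5 : a5 \in [set a4; a5] by rewrite !inE eqxx orbT.
  rewrite (ieval_rec _ h5).
  have -> : [set a4; a5] :\ a5 = [set a4].
    by apply/setP => z; rewrite !inE; case: (eqVneq z a5) => [->|]; rewrite ?orbF //= eq_sym (negbTE d45).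
  have -> : [set a4; a5] :\: cnbh a5 = set0.
    by apply/setP => z; rewrite !inE; case: (eqVneq z a5) => //= _; case: eqP => [->|]; rewrite ?e54 ?andbF.
  by rewrite ieval_set1 ieval0 mulr1.
rewrite cB; case h1: (a1 \in B); case h3: (a3 \in B).
- have -> : beyond [set a2; a4; a5] B = set0.
    apply/setP => z; rewrite bey forallB h1 h3 !inE.
    by apply/negP => /andP[/orP[/orP[]|]/eqP->]; rewrite ?e12 ?e15 ?e34 ?andbF.
  have -> : beyond [set a2] B = set0.
    apply/setP => z; rewrite bey forallB h1 h3 !inE.
    by apply/negP => /andP[/eqP->]; rewrite e12.
  by rewrite !ieval0 mul1r mulr1.
- have -> : beyond [set a2; a4; a5] B = [set a4].
    apply/setP => z; rewrite bey forallB h1 h3 !inE /= andbT.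
    apply/andP/eqP => [[/orP[/orP[]|]/eqP->]|->]; rewrite ?e12 ?e15 //.
    by rewrite eqxx orbT.
  have -> : beyond [set a2] B = set0.
    apply/setP => z; rewrite bey forallB h1 h3 !inE.
    by apply/negP => /andP[/eqP->]; rewrite e12.
  by rewrite ieval_set1 ieval0 mulr1.
- have -> : beyond [set a2; a4; a5] B = [set a5].
    apply/setP => z; rewrite bey forallB h1 h3 !inE /=.
    apply/andP/eqP => [[/orP[/orP[]|]/eqP->]|->]; rewrite ?e32 ?e34 //.
    by rewrite eqxx orbT.
  have -> : beyond [set a2] B = set0.
    apply/setP => z; rewrite bey forallB h1 h3 !inE.
    by apply/negP => /andP[/eqP->]; rewrite e32.
  by rewrite ieval_set1 ieval0 mulr1.
have b0 (S : {set G}) : beyond S B = S.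
  by apply/setP => z; rewrite bey forallB h1 h3 !andbT.
by rewrite !b0 e2 ieval_set1 y1; field.
Qed.

End Transfer.

(** * Length of the cycle and admissible attachments *)

Section Structure.
Variable G : sgraph.
Implicit Types (u v r w x y z a b : G) (A B E S T U X Y C : {set G}) (c : seq G).

Lemma cycle_edges_mem c x : (x \in c) = (x \in cover (cycle_edges c)).
Proof.
apply/idP/bigcupP => [xc|[e /imsetP[y yc ->]]].
  by exists [set x; next c x]; [apply/imsetP; exists x|rewrite !inE eqxx].
by rewrite !inE => /orP[]/eqP->; rewrite ?mem_next.
Qed.

(** The edges of a cycle cover exactly its vertices, so uniqueness is used from here on as equality
    of vertex sets. *)
Lemma unicyclic_mem : unicyclic G ->
  exists2 c, is_cycle c & forall c' : seq G, is_cycle c' -> c' =i c.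
Proof.
case=> c c_cycle h; exists c => // c' c'_cycle x.
by rewrite cycle_edges_mem h // -cycle_edges_mem.
Qed.

Lemma cycle_numbering_adj f n i j : cycle_numbering f n -> 2 < n -> i < n -> j < n ->
  adj (f i : G) (f j) = [|| j == i.+1, i == j.+1, (i == 0) && (j == n.-1) | (j == 0) && (i == n.-1)].
Proof.
case=> _ fadj n2 ilt jlt; case: (ltngtP i j) => [ij|ji|<-].
- by rewrite fadj ?ij //; lia.
- by rewrite adj_sym fadj ?ji //; lia.
- by rewrite adj_irr; lia.
Qed.

Lemma well_covered_cycle f n : cycle_numbering f n ->
  well_covered_in [set y : G in mkseq f n] -> n < 9.
Proof.
move=> num wc; rewrite ltnNge; apply/negP => n9.
have n2 : 2 < n by apply: leq_trans n9.
have [uf _] := num.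
have fadj i j := cycle_numbering_adj num n2 (i := i) (j := j).
have finj i j := @mkseq_inj _ f n i j uf.
have sub s : all (gtn 9) s -> [set y in map f s] \subset [set y in mkseq f n].
  move=> /allP s9; apply/subsetP => y; rewrite !in_set => /mapP[i /s9 /= i9 ->].
  by apply/mkseq_mem; exists i => //; apply: leq_trans n9.
have card s : all (gtn 9) s -> uniq s -> #|[set y in map f s]| = size s.
  move=> /allP s9 us; rewrite cardsE (card_uniqP _) ?size_map // map_inj_in_uniq // => i j /s9 /= i9 /s9 /= j9.
  by apply: finj; apply: leq_trans n9.
have indep s : all (gtn 8) s -> all (fun i => i.+1 \notin s) s -> independent [set y in map f s].
  move=> /allP s9 /allP ns; apply/indepP => x y; rewrite !in_set => /mapP[i si ->] /mapP[j sj ->].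
  have := s9 i si; have := s9 j sj => /= j9 i9.
  have ij : j != i.+1 by apply: contraNneq (ns i si) => <-.
  have ji : i != j.+1 by apply: contraNneq (ns j sj) => <-.
  by rewrite fadj; lia.
(* Both sets dominate exactly the positions 0 to 8, which are distinct since n >= 9. *)
have := wc [set y in map f [:: 1; 3; 5; 7]] [set y in map f [:: 1; 4; 7]].
rewrite !card // => h; suff: false by []; apply: h; rewrite ?sub ?indep //.
move=> z; rewrite in_set => /mkseq_mem[k kn ->] /dominatesP[x]; rewrite in_set => /mapP[i si ->] hik.
have i9 : 0 < i < 8 by move: si; rewrite !inE => /or4P[]/eqP->.
have k9 : k < 9.
  case/predU1P: hik => [/finj e|]; first by rewrite e; lia.
  by rewrite fadj; lia.
have dom j : j \in [:: 1; 4; 7] -> [|| k == j, k == j.+1 | j == k.+1] ->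
    dominates [set y in map f [:: 1; 4; 7]] (f k).
  move=> js h; apply/dominatesP; exists (f j); first by rewrite in_set map_f.
  have j9 : 0 < j < 8 by move: js; rewrite !inE => /or3P[]/eqP->.
  case/orP: h => [/eqP->|h]; first by rewrite eqxx.
  by rewrite fadj; lia.
have [k3|k3] := leqP k 2; first by apply: (dom 1) => //; lia.
have [k6|k6] := leqP k 5; first by apply: (dom 4) => //; lia.
by apply: (dom 7) => //; lia.
Qed.

(** Each new u sends a single edge back; the last hypothesis forces it to end in T or in the earlier
    part of U, so u is added as a leaf. *)
Lemma grown_tree C S U T : grown C S U -> tree T -> T \subset C ->
  {in U & C :\: T, forall u z, ~~ adj u z} -> tree (U :|: T).
Proof.
move=> gS tT TC; elim: gS => {S U} [_|S U a u v gS IH aCU uS vS hu hv vu nadj].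
  by rewrite set0U.
have CS := grown_sub gS.
have [m [dis eS _ _ _]] := grown_leaves gS.
have US : U \subset S by rewrite eS; apply/subsetP => z zU; rewrite !inE zU orbT.
rewrite -setUA; apply: (@TreeLeaf _ _ a).
- by apply: IH => u' z u'U zC; apply: nadj; rewrite // inE u'U orbT.
- move: aCU; rewrite !inE => /orP[aC|->//]; apply/orP; right.
  apply/negPn/negP => aT; have := nadj u a; rewrite !inE eqxx aT aC => /(_ isT isT).
  by rewrite hu ?eqxx // (subsetP CS).
- by apply: contraNN uS; rewrite inE => /orP[/(subsetP US)|/(subsetP TC)/(subsetP CS)].
- by move=> x; rewrite inE => /orP[/(subsetP US)|/(subsetP TC)/(subsetP CS)] xS; apply: hu.
Qed.

Lemma grown_attached C S U : grown C S U -> U != set0 ->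
  exists2 u, u \in U & exists2 z, z \in C & adj u z.
Proof.
elim=> {S U} [|S U a u v gS IH aCU uS vS hu hv vu _]; first by rewrite eqxx.
case: (eqVneq U set0) => [U0|/IH[u' u'U [z zC h]]]; last first.
  by exists u'; [rewrite inE u'U orbT|exists z].
have aC : a \in C by move: aCU; rewrite U0 setU0.
exists u; first by rewrite !inE eqxx.
by exists a => //; rewrite hu ?eqxx // (subsetP (grown_sub gS)).
Qed.

Section Attachments.
Variables (c : seq G) (U : {set G}) (m : G -> G).
Hypothesis c_cycle : is_cycle c.
Hypothesis c_unique : forall c', is_cycle c' -> c' =i c.
Hypothesis wcG : well_covered_in [set: G].
Let C : {set G} := [set x in c].
Hypothesis mat : matched C U m.

Lemma one_cycle_neighbour u y y' : u \in U -> y \in C -> y' \in C ->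
  adj u y -> adj u y' -> y = y'.
Proof.
case: mat => CU _ _ _ uU yC y'C uy uy'; apply/eqP/negPn/negP => nyy'.
apply: (@no_ear G c c_cycle c_unique u [::] u y y') => //; last by rewrite nyy'.
by move=> z; rewrite inE => /eqP->; rewrite inE (disjointFl CU uU).
Qed.

Lemma attached_nonadj u u' y y' : u \in U -> u' \in U -> y \in C -> y' \in C ->
  adj u y -> adj u' y' -> ~~ adj u u'.
Proof.
case: mat => CU _ _ _ uU u'U yC y'C uy u'y'; apply/negP => uu'.
apply: (@no_ear G c c_cycle c_unique u [:: u'] u' y y'); rewrite ?orbT //=.
- by rewrite uu'.
- by rewrite inE andbT; apply: contraTneq uu' => ->; rewrite adj_irr.
- by move=> z; rewrite !inE => /orP[]/eqP->; have := disjointFl CU; [move/(_ _ uU)|move/(_ _ u'U)]; rewrite !inE => ->.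
Qed.

Definition attached z : bool := [exists u in U, adj u z].

(* Exchanging the neighbours in U of B, together with E, for their leaves
   together with E and r, yields a larger set which dominates no more. *)
Lemma no_exchange B E r : B \subset C -> E \subset C -> [disjoint B & E] -> r \in B ->
    independent (r |: E) ->
    {in C, forall z, z \in cnbh r -> dominates E z || (z \in B) && attached z} ->
  False.
Proof.
move=> BC EC BE rB iE hz; have [CU eT mN madj] := mat.
have rE : r \notin E by rewrite (disjointFr BE).
have rC := subsetP BC _ rB.
pose D := [set u in U | [exists b in B, adj u b]].
have DU : D \subset U by apply/subsetP => u; rewrite inE => /andP[].
have DE : [disjoint D & E] by apply: disjointWl DU _; rewrite disjoint_sym; apply: disjointWl CU.
have mDC : [disjoint m @: D & C].
  apply/pred0P => z /=; apply/negP => /andP[/imsetP[u uD ->] mC].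
  by have := mN u (subsetP DU _ uD); rewrite inE mC.
have iXE : independent E by move: iE; rewrite indepU1 => /andP[].
have CsubC z : z \in r |: E -> z \in C by rewrite in_setU1 => /predU1P[->//|/(subsetP EC)].
have := wcG (X := m @: D :|: (r |: E)) (Y := D :|: E) (subsetT _) (subsetT _).
have -> : #|m @: D :|: (r |: E)| = (#|D| + #|E|).+1.
  rewrite cardsU cardsU1 rE card_in_imset; last first.
    by move=> a b aD bD; apply: (matched_inj mat); apply: (subsetP DU).
  rewrite disjoint_setI0 ?cards0 ?subn0 ?addnS //.
  by apply: disjointWr mDC; apply/subsetP => z; apply: CsubC.
rewrite cardsU disjoint_setI0 // cards0 subn0 ltnn => h; suff: false by []; apply: h.
- have nmD d z : d \in m @: D -> z \notin U -> ~~ adj d z.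
    case/imsetP=> u uD -> zU; rewrite madj ?(subsetP DU) //.
    by apply: contraNneq zU => ->; apply: (subsetP DU).
  have NU z : z \in m @: D :|: (r |: E) -> z \notin U.
    rewrite in_setU => /orP[/imsetP[u uD ->]|/CsubC zC]; last by rewrite (disjointFr CU).
    by have := mN u (subsetP DU _ uD); rewrite inE negb_or => /andP[].
  apply/indepP => x y xX yX; have xU := NU x xX; have yU := NU y yX.
  move: xX yX; rewrite in_setU [y \in _]in_setU => /orP[xm _|xE]; first exact: nmD.
  by case/orP=> [ym|yE]; [rewrite adj_sym nmD|apply: (indepP _ iE)].
- have nDE u e : u \in D -> e \in E -> ~~ adj u e.
    rewrite inE => /andP[uU /exists_inP[b bB ub]] eE; apply/negP => ue.
    have := one_cycle_neighbour uU (subsetP BC _ bB) (subsetP EC _ eE) ub ue.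
    by move=> e'; move: (disjointFr BE bB); rewrite e' eE.
  apply/indepP => x y; rewrite in_setU [y \in _]in_setU => /orP[xD|xE] /orP[yD|yE].
  + move: xD yD; rewrite !inE => /andP[xU /exists_inP[b bB xb]] /andP[yU /exists_inP[b' b'B yb']].
    by apply: (attached_nonadj xU yU _ _ xb yb'); apply: (subsetP BC).
  + exact: nDE.
  + by rewrite adj_sym nDE.
  + exact: (indepP _ iXE).
move=> z _ /dominatesP[x]; rewrite in_setU in_setU1.
case/orP=> [/imsetP[u uD ->] h|/orP[/eqP->|xE] h].
- apply/dominatesP; exists u; first by rewrite inE uD.
  case/predU1P: h => [->|]; first by rewrite adj_sym madj ?(subsetP DU) // eqxx orbT.
  by rewrite madj ?(subsetP DU) // => ->.
- have sub b : dominates E b -> dominates (D :|: E) b.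
    by case/dominatesP=> e eE he; apply/dominatesP; exists e; rewrite // inE eE orbT.
  have zr : z \in cnbh r by rewrite inE.
  case: (boolP (z \in C)) => zC.
    case/orP: (hz z zC zr) => [/sub//|/andP[zB /exists_inP[u uU uz]]].
    apply/dominatesP; exists u; last by rewrite uz orbT.
    by rewrite !inE uU /=; apply/orP; left; apply/exists_inP; exists z.
  case/predU1P: h => [e|h]; first by rewrite e rC in zC.
  have zU : z \in U.
    have : z \in [set: G] by rewrite inE.
    rewrite eT !in_setU (negbTE zC) /= => /orP[//|/imsetP[u uU ez]].
    move: h; rewrite adj_sym ez madj // => /eqP er.
    by move: (disjointFr CU rC); rewrite er uU.
  apply/dominatesP; exists z; last by rewrite eqxx.
  by rewrite !inE zU /=; apply/orP; left; apply/exists_inP; exists r; rewrite // adj_sym.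
- by apply/dominatesP; exists x; rewrite ?inE ?xE ?orbT.
Qed.

End Attachments.
End Structure.

Section StructureTheorem.
Variable G : sgraph.
Implicit Types (a x y z : G) (C K U : {set G}) (c : seq G).

Definition tree_reducible : Prop := exists (K : {set G}) N,
  [/\ tree K, #|K| = N.+1, #|G| = N.*2.+1 &
    forall (F : fieldType) (x : F), (1 + x != 0)%R ->
      ieval [set: G] x = ((1 + x) ^+ N * ieval K (x / (1 + x)))%R].

Definition core c U (m : G -> G) : Prop :=
  [/\ is_cycle c, forall c', is_cycle c' -> c' =i c,
      grown [set x in c] [set: G] U & matched [set x in c] U m].

(** Rotation permits stating the results on listed cycles for fixed positions only. *)
Lemma core_rot k c U m : core c U m -> core (rot k c) U m.
Proof.
case=> c_cycle c_unique gr mat.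
have e : [set x in rot k c] = [set x in c] by apply/setP => x; rewrite !inE mem_rot.
rewrite /core e; split=> //; first by move: c_cycle; rewrite /is_cycle /ucycleb size_rot rot_cycle rot_uniq.
by move=> c' /c_unique h x; rewrite h mem_rot.
Qed.

Lemma core_adj x0 c U m i j : core c U m -> i < size c -> j < size c ->
  adj (nth x0 c i) (nth x0 c j) =
  [|| j == i.+1, i == j.+1, (i == 0) && (j == (size c).-1) | (j == 0) && (i == (size c).-1)].
Proof.
case=> c_cycle c_unique _ _; apply: cycle_numbering_adj; first exact: cycle_chordless.
by case/andP: c_cycle.
Qed.

Lemma attachedPn U z : ~~ attached U z -> {in U, forall u, ~~ adj u z}.
Proof. by rewrite negb_exists_in => /forall_inP. Qed.

Lemma card_core c U m : core c U m -> #|G| = size c + #|U|.*2.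
Proof.
case=> c_cycle _ _ /card_matched ->; rewrite cardsE (card_uniqP _) //.
by case/andP: c_cycle => _ /andP[].
Qed.

Lemma tri_reducible a1 a2 a3 U m : core [:: a1; a2; a3] U m -> ~~ attached U a3 ->
  tree_reducible.
Proof.
move=> co /attachedPn Ua3; have [c_cycle c_unique gr mat] := co.
have A i j := @core_adj a1 _ _ _ i j co.
have eC : [set x in [:: a1; a2; a3]] = [set a1; a2] :|: [set a3].
  by apply/setP => x; rewrite !inE orbA.
have un : uniq [:: a1; a2; a3] by case/andP: c_cycle => _ /andP[].
move: un; rewrite /= !inE negb_or => /and3P[/andP[n12 n13] n23 _].
have TC : [set a1; a2] \subset [set x in [:: a1; a2; a3]] by rewrite eC subsetUl.
have [CU _ _ _] := mat.
exists (U :|: [set a1; a2]), #|U|.+1; split.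
- apply: (grown_tree gr) => //.
    apply: (@TreeLeaf _ [set a2] a2); rewrite ?inE //; first exact: Tree1.
    by move=> x; rewrite inE => /eqP->; rewrite eqxx (A 0 1).
  move=> u z uU; rewrite in_setD eC => /andP[zn].
  by rewrite in_setU (negbTE zn) /= inE => /eqP->; apply: Ua3.
- rewrite cardsU cards2 n12 disjoint_setI0 ?cards0 ?subn0 ?addn2 //.
  by rewrite disjoint_sym; apply: disjointWl TC CU.
- by rewrite (card_core co) doubleS.
- move=> F x x1; apply: (ieval_tri x1 mat eC n13 n23) => //.
  + by rewrite (A 0 1).
  + by rewrite (A 0 2).
  + by rewrite (A 1 2).
Qed.

Lemma pent_reducible a1 a2 a3 a4 a5 U m : core [:: a1; a2; a3; a4; a5] U m ->
  ~~ attached U a2 -> ~~ attached U a4 -> ~~ attached U a5 -> tree_reducible.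
Proof.
move=> co /attachedPn Ua2 /attachedPn Ua4 /attachedPn Ua5.
have [c_cycle c_unique gr mat] := co.
have A i j := @core_adj a1 _ _ _ i j co.
have eC : [set x in [:: a1; a2; a3; a4; a5]] = [set a1; a3] :|: [set a2; a4; a5].
  by apply/setP => x; rewrite !inE; do !case: (_ == _).
have un : uniq [:: a1; a2; a3; a4; a5] by case/andP: c_cycle => _ /andP[].
have := un; rewrite [uniq _]/= !inE !negb_or => /and5P[/and4P[d12 d13 d14 d15] /and3P[d23 d24 d25] /andP[d34 d35] d45 _].
have TC : [set a1; a3] :|: [set a2] \subset [set x in [:: a1; a2; a3; a4; a5]].
  by rewrite eC; apply: setUS; rewrite sub1set !inE eqxx.
have [CU _ _ _] := mat.
exists (U :|: ([set a1; a3] :|: [set a2])), #|U|.+2; split.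
- apply: (grown_tree gr) => //.
    rewrite -setUA; apply: (@TreeLeaf _ [set a3; a2] a2); rewrite ?inE ?eqxx ?orbT //.
    + apply: (@TreeLeaf _ [set a2] a2); rewrite ?inE //; first exact: Tree1.
        by rewrite eq_sym.
      by move=> x; rewrite inE => /eqP->; rewrite eqxx (A 2 1).
    + by rewrite negb_or d12 d13.
    + move=> x; rewrite !inE => /orP[]/eqP->; first by rewrite (A 0 2) // (eq_sym a3) (negbTE d23).
      by rewrite eqxx (A 0 1).
  move=> u z uU; rewrite in_setD eC !inE !negb_or => /andP[/andP[/andP[/negbTE-> /negbTE->] /negbTE->]] /=.
  by case/orP=> /eqP->; [apply: Ua4|apply: Ua5].
- rewrite cardsU disjoint_setI0; last by rewrite disjoint_sym; apply: disjointWl TC CU.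
  rewrite cards0 subn0 setUC cardsU1 cards2 !inE d13 negb_or eq_sym d12 d23.
  by rewrite addn3.
- by rewrite (card_core co) !doubleS.
- move=> F x x1; rewrite setUA; apply: (ieval_pent x1 mat eC un).
  + by rewrite (A 0 1).
  + by rewrite (A 1 2).
  + by rewrite (A 2 3).
  + by rewrite (A 3 4).
  + by rewrite (A 4 0).
  + by rewrite (A 0 2).
  + by rewrite (A 0 3).
  + by rewrite (A 1 3).
  + by rewrite (A 1 4).
  + by rewrite (A 2 4).
  + move=> u p uU; rewrite !inE => /orP[/orP[]|]/eqP->; by [apply: Ua2|apply: Ua4|apply: Ua5].
Qed.

Hypothesis wcG : well_covered_in [set: G].

(** With three attachments the neighbours in U dominate the triangle, so their leaves together with
    a1 form the larger set; E is empty. *)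
Lemma tri_attached a1 a2 a3 U m : core [:: a1; a2; a3] U m ->
  ~~ [&& attached U a1, attached U a2 & attached U a3].
Proof.
move=> [c_cycle c_unique _ mat]; apply/negP => /and3P[h1 h2 h3].
apply: (no_exchange c_cycle c_unique wcG mat (B := [set x in [:: a1; a2; a3]]) (E := set0) (r := a1)).
- exact: subxx.
- exact: sub0set.
- by rewrite -setI_eq0 setI0.
- by rewrite !inE eqxx.
- by rewrite setU0; apply/indepP => x y; rewrite !inE => /eqP-> /eqP->; rewrite adj_irr.
- move=> z zC _; rewrite zC orbC /=.
  by move: zC; rewrite !inE => /or3P[]/eqP->; rewrite ?h1 ?h2 ?h3.
Qed.

Lemma pent_attached a1 a2 a3 a4 a5 U m : core [:: a1; a2; a3; a4; a5] U m ->
  ~~ (attached U a1 && attached U a2).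
Proof.
move=> co; have [c_cycle c_unique _ mat] := co; apply/negP => /andP[h1 h2].
have A i j := @core_adj a1 _ _ _ i j co.
have un : uniq [:: a1; a2; a3; a4; a5] by case/andP: c_cycle => _ /andP[].
have := un; rewrite [uniq _]/= !inE !negb_or => /and5P[/and4P[d12 d13 d14 d15] /and3P[d23 d24 d25] /andP[d34 d35] d45 _].
(* Around r = a1, the vertices a1 and a2 are dominated by their attachments and a5 by a4. *)
apply: (no_exchange c_cycle c_unique wcG mat (B := [set a1; a2]) (E := [set a4]) (r := a1)).
- by apply/subsetP => x; rewrite !inE => /orP[]->; rewrite ?orbT.
- by apply/subsetP => x; rewrite !inE => ->; rewrite ?orbT.
- by rewrite disjoint_sym disjoints1 !inE negb_or eq_sym d14 eq_sym d24.
- by rewrite !inE eqxx.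
- rewrite indepU1; apply/andP; split.
    exact: independent1.
  by apply/forall_inP => x; rewrite inE => /eqP->; rewrite (A 0 3).
move=> z; rewrite !inE => /or4P[|||/orP[]]/eqP->.
- by rewrite h1 !eqxx orbT.
- by rewrite h2 !eqxx !orbT.
- by rewrite eq_sym (negbTE d13) (A 0 2).
- by rewrite eq_sym (negbTE d14) (A 0 3).
- by move=> _; apply/orP; left; apply/dominatesP; exists a4; rewrite ?inE // (A 3 4) // orbT.
Qed.

Lemma hept_attached a1 a2 a3 a4 a5 a6 a7 U m : core [:: a1; a2; a3; a4; a5; a6; a7] U m ->
  ~~ attached U a1.
Proof.
move=> co; have [c_cycle c_unique _ mat] := co; apply/negP => h1.
have A i j := @core_adj a1 _ _ _ i j co.
have un : uniq [:: a1; a2; a3; a4; a5; a6; a7] by case/andP: c_cycle => _ /andP[].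
have ne i j : i < 7 -> j < 7 -> i != j -> nth a1 [:: a1; a2; a3; a4; a5; a6; a7] i != nth a1 [:: a1; a2; a3; a4; a5; a6; a7] j.
  by move=> i7 j7; apply: contraNneq => /eqP; rewrite nth_uniq.
(* Around r = a1, the neighbours a2 and a7 are dominated by a3 and a6, which are not adjacent; this
   room is what the 7-cycle offers. *)
apply: (no_exchange c_cycle c_unique wcG mat (B := [set a1]) (E := [set a3; a6]) (r := a1)).
- by apply/subsetP => x; rewrite !inE => ->.
- by apply/subsetP => x; rewrite !inE => /orP[]->; rewrite ?orbT.
- by rewrite disjoints1 !inE negb_or (ne 0 2) // (ne 0 5).
- by rewrite inE.
- rewrite indepU1; apply/andP; split.
    apply/indepP => x y; rewrite !inE => /orP[]/eqP-> /orP[]/eqP->; rewrite ?adj_irr //.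
      by rewrite (A 2 5).
    by rewrite (A 5 2).
  by apply/forall_inP => x; rewrite !inE => /orP[]/eqP->; rewrite ?(A 0 2) ?(A 0 5).
move=> z; rewrite [z \in [set x in _]]inE in_set => zc.
have [i i7 ->] : exists2 i, i < 7 & z = nth a1 [:: a1; a2; a3; a4; a5; a6; a7] i.
  by exists (index z [:: a1; a2; a3; a4; a5; a6; a7]); [rewrite (_ : 7 = size [:: a1; a2; a3; a4; a5; a6; a7]) // index_mem|rewrite nth_index].
have dom3 y : adj a3 y -> dominates [set a3; a6] y.
  by move=> h; apply/dominatesP; exists a3; rewrite ?inE ?eqxx // h orbT.
have dom6 y : adj a6 y -> dominates [set a3; a6] y.
  by move=> h; apply/dominatesP; exists a6; rewrite ?inE ?eqxx ?orbT // h orbT.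
have := A 0 i isT i7; have := ne i 0 i7 isT.
case: i i7 => [|i] i7 nei -> /=; first by move=> _; rewrite inE eqxx h1 orbT.
rewrite (negbTE (nei isT)) /=.
case: i i7 {nei} => [|[|[|[|[|[|//]]]]]] //= _ _.
  by rewrite dom3 // (A 2 1).
by rewrite dom6 // (A 5 6).
Qed.

End StructureTheorem.

Theorem well_covered_unicyclic_structure (G : sgraph) :
  connected G -> well_covered G -> unicyclic G -> odd #|G| ->
  tree_reducible G \/
  exists2 f : nat -> G, cycle_numbering f 7 & [set: G] = [set y in mkseq f 7].
Proof.
move=> conn /well_covered_inT wc /unicyclic_mem[c c_cycle c_unique] oG.
have [|||| U gr] := well_covered_grown c_cycle c_unique (S := [set: G]) => //.
- by rewrite cardsT.
- exact: connected_inT.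
have [m [CU eT mN madj _]] := grown_leaves gr.
have mat : matched [set x in c] U m.
  by split=> // u uU x; apply: madj; rewrite ?inE.
have co : core c U m by split.
have [x0 x0c] : exists x, x \in c.
  by case: (c) c_cycle => // x s _; exists x; rewrite inE eqxx.
have num := cycle_chordless c_cycle c_unique x0.
have c9 : size c < 9.
  apply: (well_covered_cycle num).
  have -> : [set y in mkseq (nth x0 c) (size c)] = [set x in c] by rewrite mkseq_nth.
  exact: grown_well_covered gr wc.
have oc : odd (size c) by move: oG; rewrite (card_core co) oddD odd_double addbF.
have c3 : 2 < size c by case/andP: c_cycle.
have rotk k := core_rot k co.
case: c {c_cycle c_unique gr CU eT mN madj mat x0c num} co c9 oc c3 rotk => //= a1 [|a2 [|a3 [|a4 s]]] // co.
  move=> _ _ _ rotk; left; have := tri_attached wc co.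
  rewrite !negb_and => /or3P[h|h|h].
  - exact: (tri_reducible (rotk 1) h).
  - exact: (tri_reducible (rotk 2) h).
  - exact: (tri_reducible co h).
case: s co => [|a5 [|a6 s]] // co.
  move=> _ _ _ rotk; left.
  (* The attached vertices are pairwise non-adjacent on the pentagon, so some rotation puts them all
     at positions 1 and 3. *)
  have := pent_attached wc co; have := pent_attached wc (rotk 1); have := pent_attached wc (rotk 2).
  have := pent_attached wc (rotk 3); have := pent_attached wc (rotk 4).
  have := @pent_reducible _ _ _ _ _ _ _ _ co; have := @pent_reducible _ _ _ _ _ _ _ _ (rotk 1).
  have := @pent_reducible _ _ _ _ _ _ _ _ (rotk 2); have := @pent_reducible _ _ _ _ _ _ _ _ (rotk 3).
  have := @pent_reducible _ _ _ _ _ _ _ _ (rotk 4).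
  case: (attached U a1) => /=; case: (attached U a2) => //=; case: (attached U a3) => //=;
  case: (attached U a4) => //=; case: (attached U a5) => //= h1 h2 h3 h4 h5;
  by [apply: h1|apply: h2|apply: h3|apply: h4|apply: h5].
case: s co => [|a7 [|a8 [|a9 s]]] // co _ _ _ rotk; right.
have [c_cycle c_unique gr mat] := co.
(* Otherwise some u touches the cycle directly, and rotating its neighbour to the front contradicts
   [hept_attached]. *)
case: (eqVneq U set0) => [U0|/(grown_attached gr)[u uU [z]]].
  exists (nth a1 [:: a1; a2; a3; a4; a5; a6; a7]); first exact: (cycle_chordless c_cycle c_unique a1).
  by have [_ eT _ _] := mat; rewrite eT U0 imset0 !setU0.
rewrite inE => zc uz; exfalso; have [i s es] := rot_to zc.
have := rotk i; rewrite es; have : size (z :: s) = 7 by rewrite -es size_rot.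
case: s {es} => [|b2 [|b3 [|b4 [|b5 [|b6 [|b7 [|//]]]]]]] // _ co'.
by have /negP := hept_attached wc co'; apply; apply/exists_inP; exists u.
Qed.

(** * The families of the theorem *)

Section Isomorphism.
Local Open Scope ring_scope.

Lemma ieval_iso (K : comNzRingType) (G H : sgraph) (x : K) : graph_iso G H ->
  ieval [set: G] x = ieval [set: H] x.
Proof.
case=> f [g fK gK] fadj; rewrite /ieval.
rewrite [RHS](reindex_onto (fun T : {set G} => f @: T) (fun T : {set H} => g @: T)) /=; last first.
  by move=> T _; rewrite -imset_comp (eq_imset _ (g := id)) ?imset_id.
apply: eq_big => [T|T _]; last by rewrite card_imset //; exact: can_inj fK.
rewrite !subsetT /= -imset_comp (eq_imset _ (g := id)) ?imset_id ?eqxx ?andbT //.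
apply/indepP/indepP => iT x' y'.
  by case/imsetP=> a aT -> /imsetP[b bT ->]; rewrite fadj iT.
by move=> xT yT; rewrite -fadj iT ?imset_f.
Qed.

Lemma card_iso (G H : sgraph) : graph_iso G H -> #|G| = #|H|.
Proof. by case=> f bf _; exact: bij_eq_card bf. Qed.

Lemma ieval_path_pos (K : comNzRingType) (G : sgraph) (A : {set G}) (pos : G -> nat) n (x : K) :
    {in A &, injective pos} -> (forall i, (i < n)%N -> exists2 v, v \in A & pos v = i) ->
    {in A, forall v, (pos v < n)%N} ->
    {in A &, forall v w, adj v w = (pos v == (pos w).+1) || (pos w == (pos v).+1)} ->
  ieval A x = path_value x n.
Proof.
move=> pinj psurj plt padj; pose B k := [set v in A | (pos v < k)%N].
have -> : A = B n by apply/setP => v; rewrite inE; case vA: (v \in A) => //=; rewrite plt.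
suff main k : (k <= n)%N -> ieval (B k) x = path_value x k by exact: main.
have [j] := ubnP k; elim: j k => // j IH [|[|k]] ltk kn.
- by rewrite (_ : B 0 = set0) ?ieval0 //; apply/setP => v; rewrite !inE andbF.
- have [v vA pv] := psurj 0 kn.
  have -> : B 1 = [set v].
    apply/setP => w; rewrite !inE ltnS leqn0; apply/andP/eqP => [[wA /eqP pw]|->]; last by rewrite vA pv.
    by apply: pinj; rewrite // pw pv.
  by rewrite ieval_set1.
have [v vA pv] := psurj k.+1 kn.
have vB : v \in B k.+2 by rewrite inE vA pv /=.
rewrite (ieval_rec _ vB) path_valueSS -(IH k.+1 ltk (ltnW kn)) -(IH k (ltnW ltk) (ltnW (ltnW kn))).
congr (_ + _ * _); congr (ieval _ _); apply/setP => w; rewrite !inE.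
  case wA: (w \in A); last by rewrite !andbF.
  rewrite /= [RHS]ltnS ltnS leq_eqVlt; case: (eqVneq w v) => [->|nwv] /=; first by rewrite pv ltnn.
  have -> : (pos w == k.+1) = false.
    by apply: contraNF nwv => /eqP pw; apply/eqP/pinj; rewrite // pw pv.
  by rewrite ltnS.
case wA: (w \in A); last by rewrite !andbF.
rewrite /= padj // pv; case: (eqVneq w v) => [->|nwv] /=; first by rewrite pv; lia.
have : pos w != k.+1 by apply: contraNneq nwv => pw; apply/eqP/pinj; rewrite // pw pv.
by lia.
Qed.

End Isomorphism.

Section CycleGraph.

Lemma cycle_graph_numbering n :
  cycle_numbering (fun i => inord i : cycle_graph n.+3) n.+3 /\
  [set: cycle_graph n.+3] = [set y in mkseq (fun i => inord i : cycle_graph n.+3) n.+3].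
Proof.
split; last first.
  apply/setP => y; rewrite in_setT in_set; apply/esym/mkseq_mem; exists y => //.
  by rewrite inord_val.
have iv i : i < n.+3 -> (inord i : 'I_n.+3) = i :> nat by apply: inordK.
split.
  apply/(uniqP ord0) => i j; rewrite !inE !size_mkseq => il jl.
  by rewrite !nth_mkseq // => e; rewrite -(iv i il) -(iv j jl); congr (nat_of_ord _).
move=> i j /andP[ij jn]; have il := ltn_trans ij jn.
rewrite /adj /= /sym_rel -val_eqE /= !iv //.
rewrite (modn_small (leq_ltn_trans ij jn)).
have [->|nj] := eqVneq j n.+2; first by rewrite modnn; lia.
have jl : j.+1 < n.+3 by lia.
by rewrite modn_small //; lia.
Qed.

End CycleGraph.

Lemma inl_eqE (A B : eqType) (a b : A) : (inl a == inl b :> A + B) = (a == b).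
Proof. by []. Qed.

Lemma inr_eqE (A B : eqType) (a b : B) : (inr a == inr b :> A + B) = (a == b).
Proof. by []. Qed.

Section MAdjacency.
Variables (n : nat).
Implicit Types (i : 'I_3) (j : 'I_((n - 3) %/ 2)) (b : bool).

Lemma M_adj_ll i i' : @adj (M n) (inl i) (inl i') = (i != i').
Proof. by rewrite /adj /= /sym_rel inl_eqE andbT. Qed.

Lemma M_adj_lr i j b : @adj (M n) (inl i) (inr (j, b)) = (i == 0 :> nat) && ~~ b.
Proof. by rewrite /adj /= /sym_rel /= orbF. Qed.

Lemma M_adj_rr j j' b b' : @adj (M n) (inr (j, b)) (inr (j', b')) = (j == j') && (b != b').
Proof.
rewrite /adj /= /sym_rel /= inr_eqE xpair_eqE (eq_sym j') (eq_sym b') orbb.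
by case: eqP => //=; case: eqP.
Qed.

End MAdjacency.

Section Families.
Local Open Scope ring_scope.
Variables (K : fieldType) (x : K).
Hypothesis x1 : 1 + x != 0.

(** Summing out a3 and the leaves of U leaves the star centred at a1, whose k + 1 leaves are a2 and
    the vertices of U; its value at y is (1 + y)^(k+1) + y. *)
Lemma ieval_M n : let k := ((n - 3) %/ 2)%N in
  ieval [set: M n] x = (1 + x) ^+ k.+1 * ((1 + x / (1 + x)) ^+ k.+1 + x / (1 + x)).
Proof.
move=> k; pose V : finType := ('I_3 + 'I_k * bool)%type.
pose a1 : M n := (inl ord0 : V); pose a2 : M n := (inl (inord 1) : V).
pose a3 : M n := (inl (inord 2) : V).
pose U : {set M n} := [set z : V | if z is inr (_, b) then ~~ b else false].
pose m (z : M n) : M n := if (z : V) is inr (j, _) then (inr (j, true) : V) else z.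
pose C : {set M n} := [set z : V | if z is inl _ then true else false].
have o3 (i : 'I_3) : [|| i == ord0, i == inord 1 | i == inord 2].
  by case: i => [[|[|[|]]]] // h; rewrite -!val_eqE /= ?inordK.
have n01 : (ord0 : 'I_3) != inord 1 by rewrite -val_eqE /= inordK.
have n02 : (ord0 : 'I_3) != inord 2 by rewrite -val_eqE /= inordK.
have n12 : (inord 1 : 'I_3) != inord 2 by rewrite -val_eqE /= !inordK.
have cU : #|U| = k.
  pose h (j : 'I_k) : M n := (inr (j, false) : V).
  have -> : U = h @: 'I_k.
    apply/setP => z; rewrite inE; apply/idP/imsetP; last by case=> j _ ->.
    by case: z => // -[j []] // _; exists j.
  by rewrite card_imset ?card_ord // => i j [].
have mat : matched C U m.
  split.
  - by apply/pred0P => -[i|[j b]]; rewrite /= !inE ?andbF.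
  - apply/esym/setP => z; rewrite !inE; case: z => [i|[j []]] //=.
    apply/imsetP; exists (inr (j, false) : V) => //; by rewrite inE.
  - by move=> [i|[j []]]; rewrite !inE.
  - move=> [i|[j []]]; rewrite !inE // => _ [i|[j' b']]; rewrite /m.
      by rewrite adj_sym M_adj_lr andbF.
    rewrite M_adj_rr inr_eqE xpair_eqE eq_sym.
    by case: b'; rewrite ?andbF.
have e12 : adj a1 a2 by rewrite M_adj_ll n01.
have e13 : adj a1 a3 by rewrite M_adj_ll n02.
have e23 : adj a2 a3 by rewrite M_adj_ll n12.
have nU (i : 'I_3) (u : M n) : u \in U -> i != 0 :> nat -> adj u (inl i : V) = false.
  by case: u => [i'|[j []]]; rewrite ?inE // => _ i0; rewrite adj_sym M_adj_lr (negbTE i0).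
have eC : C = [set a1; a2] :|: [set a3].
  by apply/setP => -[i|[j b]]; rewrite !inE //= !inl_eqE -orbA o3.
rewrite (ieval_tri x1 mat eC) ?inl_eqE //; last first.
  by move=> u uU; rewrite nU // inordK.
rewrite cU; congr (_ * _).
have a1K : a1 \in U :|: [set a1; a2] by rewrite !inE eqxx.
rewrite (ieval_rec _ a1K).
have -> : (U :|: [set a1; a2]) :\: cnbh a1 = set0.
  apply/setP => z; rewrite in_set0; apply/negP; rewrite in_setD in_setU in_set2 inE negb_or.
  move=> /andP[/andP[nz na]]; rewrite (negbTE nz) /= => /orP[zU|/eqP ez]; last by rewrite ez e12 in na.
  by case: z zU na {nz} => [i|[j []]]; rewrite inE // M_adj_lr.
have -> : (U :|: [set a1; a2]) :\ a1 = U :|: [set a2].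
  apply/setP => z; rewrite !inE; case: (eqVneq z a1) => [->|] //=.
  by rewrite inl_eqE (negbTE n01).
rewrite ieval0 mulr1 ieval_indep.
  rewrite cardsU cards1 cU disjoint_setI0 ?cards0 ?subn0 ?addn1 //.
  by rewrite disjoint_sym disjoints1 inE.
apply/indepP => z w; rewrite !inE => /orP[zU|/eqP->] /orP[wU|/eqP->]; rewrite ?adj_irr //.
- by case: z zU => [|[j []]] //; case: w wU => [|[j' []]] // _ _; rewrite M_adj_rr andbF.
- by rewrite nU ?inE // inordK.
- by rewrite adj_sym nU ?inE // inordK.
Qed.

End Families.

Section StarPathAdjacency.
Variables g k l : nat.
Implicit Types (i j : 'I_g) (x y : star (path_graph k)) (z w : star (path_graph l)).

Lemma path_graph_adj n (a b : 'I_n) : @adj (path_graph n) a b = (b == a.+1 :> nat) || (a == b.+1 :> nat).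
Proof.
rewrite /adj /= /sym_rel; case: (eqVneq a b) => [->|] //=.
by rewrite orbb eqn_leq ltnn andbF.
Qed.

Lemma star_adj_ll (H : sgraph) (a b : H) : @adj (star H) (inl a) (inl b) = adj a b.
Proof.
transitivity ((a != b) && (@adj (H) a b || @adj (H) b a)); first by [].
by rewrite (@adj_sym (H) b) orbb; case: eqVneq => [->|//]; rewrite adj_irr.
Qed.

Lemma star_adj_lr (H : sgraph) (a b : H) : @adj (star H) (inl a) (inr b) = (a == b).
Proof. by rewrite /adj /= /sym_rel /= orbF. Qed.

Lemma star_adj_rr (H : sgraph) (a b : H) : @adj (star H) (inr a) (inr b) = false.
Proof. by rewrite /adj /= /sym_rel /= andbF. Qed.

Lemma Ggkl_adj_cc i j : @adj (Ggkl g k l) (inl i) (inl j) = @adj (cycle_graph g) i j.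
Proof.
transitivity ((i != j) && (@adj (cycle_graph g) i j || @adj (cycle_graph g) j i)); first by [].
by rewrite (@adj_sym (cycle_graph g) j) orbb; case: eqVneq => [->|//]; rewrite adj_irr.
Qed.

Lemma Ggkl_adj_cl i a : @adj (Ggkl g k l) (inl i) (inr (inl (inl a))) = (i == 0 :> nat) && (a == 0 :> nat).
Proof. by rewrite /adj /= /sym_rel /= orbF. Qed.

Lemma Ggkl_adj_cr i b : @adj (Ggkl g k l) (inl i) (inr (inr (inl b))) = (i == 2 :> nat) && (b == 0 :> nat).
Proof. by rewrite /adj /= /sym_rel /= orbF. Qed.

Lemma Ggkl_adj_cl' i a : @adj (Ggkl g k l) (inl i) (inr (inl (inr a))) = false.
Proof. by []. Qed.

Lemma Ggkl_adj_cr' i b : @adj (Ggkl g k l) (inl i) (inr (inr (inr b))) = false.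
Proof. by []. Qed.

Lemma Ggkl_adj_ll x y : @adj (Ggkl g k l) (inr (inl x)) (inr (inl y)) = adj x y.
Proof.
transitivity ((x != y) && (@adj (star (path_graph k)) x y || @adj (star (path_graph k)) y x)); first by [].
by rewrite (@adj_sym (star (path_graph k)) y) orbb; case: eqVneq => [->|//]; rewrite adj_irr.
Qed.

Lemma Ggkl_adj_rr z w : @adj (Ggkl g k l) (inr (inr z)) (inr (inr w)) = adj z w.
Proof.
transitivity ((z != w) && (@adj (star (path_graph l)) z w || @adj (star (path_graph l)) w z)); first by [].
by rewrite (@adj_sym (star (path_graph l)) w) orbb; case: eqVneq => [->|//]; rewrite adj_irr.
Qed.

Lemma Ggkl_adj_lr x z : @adj (Ggkl g k l) (inr (inl x)) (inr (inr z)) = false.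
Proof. by case: x z => [a|a] [b|b]. Qed.

End StarPathAdjacency.

Section FamilyG.
Local Open Scope ring_scope.
Variables (g k l : nat).

Definition Ggkl_cycle : {set Ggkl g k l} := [set z : 'I_g + (('I_k + 'I_k) + ('I_l + 'I_l)) |
  if z is inl _ then true else false].
Definition Ggkl_inner : {set Ggkl g k l} := [set z : 'I_g + (('I_k + 'I_k) + ('I_l + 'I_l)) |
  match z with inr (inl (inl _)) | inr (inr (inl _)) => true | _ => false end].
Definition Ggkl_leaf (z : Ggkl g k l) : Ggkl g k l :=
  match z with
  | inr (inl (inl a)) => inr (inl (inr a))
  | inr (inr (inl b)) => inr (inr (inr b))
  | _ => z
  end.

Lemma Ggkl_matched : matched Ggkl_cycle Ggkl_inner Ggkl_leaf.
Proof.
split.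
- by apply/pred0P => -[i|[[a|a]|[b|b]]]; rewrite /= !inE.
- apply/esym/setP => z; rewrite !inE; case: z => [i|[[a|a]|[b|b]]] //=.
    by apply/imsetP; exists (inr (inl (inl a))) => //; rewrite inE.
  by apply/imsetP; exists (inr (inr (inl b))) => //; rewrite inE.
- by move=> [i|[[a|a]|[b|b]]]; rewrite !inE.
- move=> [i|[[a|a]|[b|b]]]; rewrite !inE // => _ [i|[[a'|a']|[b'|b']]]; rewrite /Ggkl_leaf.
  + by rewrite adj_sym Ggkl_adj_cl'.
  + by rewrite Ggkl_adj_ll adj_sym star_adj_lr !inr_eqE !inl_eqE.
  + by rewrite Ggkl_adj_ll star_adj_rr.
  + by rewrite Ggkl_adj_lr.
  + by rewrite Ggkl_adj_lr.
  + by rewrite adj_sym Ggkl_adj_cr'.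
  + by rewrite adj_sym Ggkl_adj_lr.
  + by rewrite adj_sym Ggkl_adj_lr.
  + by rewrite Ggkl_adj_rr adj_sym star_adj_lr !inr_eqE !inl_eqE.
  + by rewrite Ggkl_adj_rr star_adj_rr.
Qed.

Lemma card_Ggkl : #|Ggkl g k l| = (g + (k + l).*2)%N.
Proof. by rewrite !card_sum !card_ord !addnn doubleD. Qed.

Lemma card_Ggkl_inner : #|Ggkl_inner| = (k + l)%N.
Proof.
have := card_matched Ggkl_matched; rewrite card_Ggkl.
have -> : Ggkl_cycle = (fun i : 'I_g => inl i : Ggkl g k l) @: 'I_g.
  apply/setP => z; rewrite inE; apply/idP/imsetP; last by case=> i _ ->.
  by case: z => // i _; exists i.
rewrite card_imset ?card_ord; last by move=> i j [].
by move/addnI/double_inj.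
Qed.

(** T is the retained part of the cycle, a path numbered by [phi] from c_1 at 0 to c_3 at h. It
    extends the two attached paths to one long path. *)
Lemma ieval_Ggkl_skeleton (K : comNzRingType) (x : K) (T : {set 'I_g}) (phi : 'I_g -> nat) h :
    {in T &, injective phi} -> (forall i, (i < h.+1)%N -> exists2 v, v \in T & phi v = i) ->
    {in T, forall v, (phi v < h.+1)%N} ->
    {in T &, forall i j, @adj (cycle_graph g) i j = (phi i == (phi j).+1) || (phi j == (phi i).+1)} ->
    {in T, forall i : 'I_g, (i == 0 :> nat) = (phi i == 0)} ->
    {in T, forall i : 'I_g, (i == 2 :> nat) = (phi i == h)} ->
  ieval (Ggkl_inner :|: [set (inl i : Ggkl g k l) | i in T]) x = path_value x (h + (k + l)).+1.
Proof.
move=> pinj psurj plt padj p0 p2.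
have mT (z : Ggkl g k l) : (z \in Ggkl_inner :|: [set (inl i : Ggkl g k l) | i in T]) = match z with
    | inl i => i \in T | inr (inl (inl _)) | inr (inr (inl _)) => true | _ => false end.
  rewrite !inE; case: z => [i|[[a|a]|[b|b]]] //=.
  - by apply/imsetP/idP => [[j jT [->]]|iT] //; exists i.
  - by apply/negP => /imsetP[].
  - by apply/negP => /imsetP[].
(* P_k is traversed backwards so that its end 0 gets position k - 1, next to c_1 at k; P_l starts
   just after c_3, at k + h + 1. The value 0 is a dummy for the leaves, which are outside the
   set. *)
apply: (@ieval_path_pos _ _ _ (fun z : Ggkl g k l => match z with
    | inl i => k + phi i
    | inr (inl (inl a)) => k - a.+1
    | inr (inr (inl b)) => k + h.+1 + b
    | _ => 0
    end)%N).
- move=> [i|[[a|a]|[b|b]]] [j|[[a'|a']|[b'|b']]]; rewrite !mT // => iT jT.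
  + by move/addnI/(pinj _ _ iT jT)->.
  + by have := ltn_ord a'; lia.
  + by have := plt i iT; lia.
  + by have := ltn_ord a; lia.
  + move=> e; do 3!congr (_ _); apply/val_inj => /=; have := ltn_ord a; have := ltn_ord a'; lia.
  + by have := ltn_ord a; lia.
  + by have := plt j jT; lia.
  + by have := ltn_ord a'; lia.
  + by move=> e; do 3!congr (_ _); apply/val_inj => /=; lia.
- move=> i ilt; have [ik|ki] := ltnP i k.
    have h1 : (k - i.+1 < k)%N by lia.
    by exists (inr (inl (inl (Ordinal h1)))); rewrite ?mT //=; lia.
  have [ih|hi] := ltnP i (k + h.+1).
    have [|v vT ev] := psurj (i - k)%N; first lia.
    by exists (inl v); rewrite ?mT // ev; lia.
  have h1 : (i - (k + h.+1) < l)%N by lia.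
  by exists (inr (inr (inl (Ordinal h1)))); rewrite ?mT //=; lia.
- move=> [i|[[a|a]|[b|b]]]; rewrite mT // => iT.
  + by have := plt i iT; lia.
  + by have := ltn_ord a; lia.
  + by have := ltn_ord b; lia.
move=> [i|[[a|a]|[b|b]]] [j|[[a'|a']|[b'|b']]]; rewrite !mT // => iT jT.
- by rewrite Ggkl_adj_cc padj // -!addnS !eqn_add2l.
- by rewrite Ggkl_adj_cl p0 //; have := ltn_ord a'; lia.
- by rewrite Ggkl_adj_cr p2 //; have := plt i iT; lia.
- by rewrite adj_sym Ggkl_adj_cl p0 //; have := ltn_ord a; lia.
- by rewrite Ggkl_adj_ll star_adj_ll path_graph_adj; have := ltn_ord a; have := ltn_ord a'; lia.
- by rewrite Ggkl_adj_lr; have := ltn_ord a; lia.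
- by rewrite adj_sym Ggkl_adj_cr p2 //; have := plt j jT; lia.
- by rewrite adj_sym Ggkl_adj_lr; have := ltn_ord a'; lia.
- by rewrite Ggkl_adj_rr star_adj_ll path_graph_adj; lia.
Qed.

Lemma Ggkl_inner_adj (u : Ggkl g k l) (i : 'I_g) : u \in Ggkl_inner ->
  i != 0 :> nat -> i != 2 :> nat -> ~~ adj u (inl i : Ggkl g k l).
Proof.
move=> uU i0 i2; rewrite adj_sym.
case: u uU => [j|[[a|a]|[b|b]]]; rewrite inE // => _.
  by rewrite Ggkl_adj_cl (negbTE i0).
by rewrite Ggkl_adj_cr (negbTE i2).
Qed.

End FamilyG.

Section FamilyGValue.
Local Open Scope ring_scope.
Variables (k l : nat) (K : fieldType) (x : K).
Hypothesis x1 : 1 + x != 0.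

(** On the triangle c_2 is summed out and c_1 - c_3 remains; on the pentagon below it is c_1 - c_2 -
    c_3, hence h = 1 and h = 2. *)
Lemma ieval_Ggkl3 : ieval [set: Ggkl 3 k l] x =
  (1 + x) ^+ (k + l).+1 * path_value (x / (1 + x)) (k + l).+2.
Proof.
pose o i (h : (i < 3)%N) := Ordinal h.
pose o0 := o 0 isT; pose o1 := o 1%N isT; pose o2 := o 2 isT.
pose c (i : 'I_3) : Ggkl 3 k l := inl i.
have eC : Ggkl_cycle 3 k l = [set c o0; c o2] :|: [set c o1].
  by apply/setP => -[i|z]; rewrite !inE //= !inl_eqE; case: i => [[|[|[|]]]].
rewrite (ieval_tri x1 (Ggkl_matched 3 k l) eC) ?Ggkl_adj_cc ?inl_eqE //; last first.
  by move=> u uU; apply: Ggkl_inner_adj.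
rewrite card_Ggkl_inner; congr (_ * _).
have -> : [set c o0; c o2] = [set (inl i : Ggkl 3 k l) | i in [set o0; o2]].
  by rewrite imsetU1 imset_set1.
apply: (@ieval_Ggkl_skeleton _ _ _ _ _ _ (fun i => if i == o0 then 0 else 1)%N 1).
- by move=> i j; rewrite !inE => /orP[]/eqP-> /orP[]/eqP->.
- by move=> [|[|//]] _; [exists o0|exists o2]; rewrite ?inE ?eqxx.
- by move=> i; rewrite !inE => /orP[]/eqP->.
- by move=> i j; rewrite !inE => /orP[]/eqP-> /orP[]/eqP->.
- by move=> i; rewrite !inE => /orP[]/eqP->.
- by move=> i; rewrite !inE => /orP[]/eqP->.
Qed.

Lemma ieval_Ggkl5 : ieval [set: Ggkl 5 k l] x =
  (1 + x) ^+ (k + l).+2 * path_value (x / (1 + x)) (k + l).+3.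
Proof.
pose o i (h : (i < 5)%N) := Ordinal h.
pose o0 := o 0 isT; pose o1 := o 1%N isT; pose o2 := o 2 isT; pose o3 := o 3 isT; pose o4 := o 4 isT.
pose c (i : 'I_5) : Ggkl 5 k l := inl i.
have eC : Ggkl_cycle 5 k l = [set c o0; c o2] :|: [set c o1; c o3; c o4].
  by apply/setP => -[i|z]; rewrite !inE //= !inl_eqE; case: i => [[|[|[|[|[|]]]]]].
rewrite (@ieval_pent _ _ _ x1 _ _ _ (c o0) (c o1) (c o2) (c o3) (c o4) (Ggkl_matched 5 k l) eC) ?Ggkl_adj_cc //; last first.
  by move=> u z uU; rewrite !inE => /orP[/orP[]|]/eqP->; apply: Ggkl_inner_adj.
rewrite card_Ggkl_inner; congr (_ * _).
have -> : Ggkl_inner 5 k l :|: [set c o0; c o2] :|: [set c o1] =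
    Ggkl_inner 5 k l :|: [set (inl i : Ggkl 5 k l) | i in [set o0; o2; o1]].
  by rewrite -setUA imsetU imsetU1 !imset_set1.
apply: (@ieval_Ggkl_skeleton _ _ _ _ _ _ (fun i => nat_of_ord i) 2).
- by move=> i j _ _; apply: val_inj.
- by move=> [|[|[|//]]] _; [exists o0|exists o1|exists o2]; rewrite ?inE ?eqxx.
- by move=> i; rewrite !inE => /orP[/orP[]|]/eqP->.
- by move=> i j; rewrite !inE => /orP[/orP[]|]/eqP-> /orP[/orP[]|]/eqP->.
- by [].
- by [].
Qed.

End FamilyGValue.

(** * Comparison of the roots *)

Section Comparison.
Local Open Scope ring_scope.
Variable R : realType.
Implicit Types (t : R) (G H : sgraph).

(** Before the first zero of G the argument y = t / (1 - t) is before that of K, where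
    [tree_path_bound] applies at any root. *)
Lemma tree_reducible_path G (K : {set G}) N t : tree K -> #|K| = N.+1 ->
    (forall x : R, 1 + x != 0 -> ieval [set: G] x = (1 + x) ^+ N * ieval K (x / (1 + x))) ->
    0 <= t < - xi G R -> t < 1 ->
  forall j, (j <= N.+1)%N -> 0 < path_value (- t / (1 - t)) j.
Proof.
move=> tK cK red /andP[t0 tG] t1.
have Kn0 : K != set0 by rewrite -card_gt0 cK.
have [v vK] := set0Pn _ Kn0.
have [_ _ pos] := xiP R v.
have [tau [tau0 etau posK]] := first_zero R Kn0.
have t1' : 0 < 1 - t by rewrite subr_gt0.
have y0 : 0 <= t / (1 - t) by rewrite divr_ge0 // ltW.
have ytau : t / (1 - t) < tau.
  rewrite ltNge; apply/negP => le_tau.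
  have tau1 : 0 < 1 + tau by rewrite addr_gt0.
  (* The inverse of t / (1 - t) at tau: it would be a zero of I(G, -s) with s <= t. *)
  pose s := tau / (1 + tau).
  have s0 : 0 <= s by rewrite divr_ge0 // ltW.
  have st : s <= t.
    move: le_tau; rewrite /s ler_pdivlMr // ler_pdivrMr //; lra.
  have := pos s; rewrite s0 (le_lt_trans st tG) => /(_ isT [set: G]).
  have e1 : 1 - s = (1 + tau)^-1 by rewrite /s; field; rewrite gt_eqF.
  have e2 : - s / (1 - s) = - tau.
    by rewrite e1 invrK /s; field; rewrite gt_eqF.
  by rewrite red e1 ?invr_neq0 ?gt_eqF // -e1 e2 etau mulr0 ltxx.
rewrite mulNr.
have [] := tree_path_bound y0 (tree_rooted tK vK) _ cK => // B BK.
by apply: posK; rewrite ?y0.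
Qed.

Lemma pos_lt1 G (v : G) t : (forall S : {set G}, 0 < ieval S (- t)) -> t < 1.
Proof. by move=> pos; have := pos [set v]; rewrite ieval_set1 subr_gt0. Qed.

Lemma M_pos n t : 0 <= t -> (forall S : {set M n}, 0 < ieval S (- t)) ->
  [/\ t < 1, 2 * t < 1 & t / (1 - t) < (1 - t / (1 - t)) ^+ ((n - 3) %/ 2).+1].
Proof.
move=> t0 pos.
have t1 : t < 1 by apply: pos_lt1 pos; exact: (inl ord0).
have t1' : 0 < 1 - t by rewrite subr_gt0.
split=> //; last first.
  have := pos [set: M n]; rewrite ieval_M ?gt_eqF // pmulr_rgt0 ?exprn_gt0 //.
  by rewrite mulNr subr_gt0.
(* An edge of the triangle has value 1 - 2 t, so 2 t < 1; this is what makes 1 - y positive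
   later. *)
pose a : M n := inl ord0; pose b : M n := inl ord_max.
have ab : b \notin [set a] by rewrite inE.
have := pos (b |: [set a]).
have e1 : (b |: [set a]) :\ b = [set a] by rewrite setU1K.
have e2 : (b |: [set a]) :\: cnbh b = set0.
  apply/setP => z; rewrite !inE negb_or; case: (eqVneq z b) => //= _.
  by case: eqP => [->|]; rewrite ?andbF ?andbT // M_adj_ll.
by rewrite (ieval_rec _ (setU11 b _)) e1 e2 ieval0 ieval_set1; lra.
Qed.

Lemma tree_reducible_M_pos G (K : {set G}) N n t : tree K -> #|K| = N.+1 -> n = N.*2.+1 -> (0 < N)%N ->
    (forall x : R, 1 + x != 0 -> ieval [set: G] x = (1 + x) ^+ N * ieval K (x / (1 + x))) ->
    0 <= t -> (forall S : {set M n}, 0 < ieval S (- t)) ->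
  0 < ieval [set: G] (- t).
Proof.
move=> tK cK en N0 red t0 /(M_pos t0)[t1 t2].
have -> : ((n - 3) %/ 2).+1 = N by lia.
have t1' : 0 < 1 - t by rewrite subr_gt0.
have y0 : 0 <= t / (1 - t) by rewrite divr_ge0 // ltW.
have q0 : 0 < 1 - t / (1 - t) by rewrite subr_gt0 ltr_pdivrMr //; lra.
have /set0Pn[v vK] : K != set0 by rewrite -card_gt0 cK.
move=> yN; have [_ pK _] := tree_star_bound y0 (tree_rooted tK vK) yN q0 cK (leqnn N).
by rewrite red ?gt_eqF // mulNr mulr_gt0 // exprn_gt0.
Qed.

(** The value at -t for the cycle of length 2 N + 1, N > 0, split at one vertex. *)
Definition cycle_value t N := path_value (- t) N.*2 + - t * path_value (- t) N.*2.-2.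

Lemma cycle_value3_pos t : 0 <= t -> 4 * t < 1 -> 0 < cycle_value t 3.
Proof.
move=> t0 t4.
have -> : cycle_value t 3 = (1 - 4 * t) * (1 - t) * (1 - 2 * t) + t ^+ 3.
  by rewrite /cycle_value /=; ring.
by rewrite ltr_wpDr ?exprn_ge0 // !mulr_gt0 //; lra.
Qed.

(** C_3 and C_5 themselves reduce to paths on 2 and 3 vertices, which gives identities. For C_7 the
    path values at 1 and 4 give 2 t < 1 and 4 t < 1. *)
Lemma cycle_value_pos N t : (0 < N < 4)%N -> 0 <= t -> t < 1 ->
    (forall j, (j <= N.+1)%N -> 0 < path_value (- t / (1 - t)) j) ->
  0 < cycle_value t N.
Proof.
case: N => [|[|[|[|//]]]] // _ t0 t1 pos; have t1' : 0 < 1 - t by rewrite subr_gt0.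
- have -> : cycle_value t 1 = (1 - t) * path_value (- t / (1 - t)) 2.
    by rewrite /cycle_value /=; field; rewrite gt_eqF.
  by rewrite mulr_gt0 // pos.
- have -> : cycle_value t 2 = (1 - t) ^+ 2 * path_value (- t / (1 - t)) 3.
    by rewrite /cycle_value /=; field; rewrite gt_eqF.
  by rewrite mulr_gt0 ?exprn_gt0 // pos.
have p1 := pos 1%N isT; have p4 := pos 4 isT.
have e1 : path_value (- t / (1 - t)) 1 = (1 - 2 * t) / (1 - t).
  by rewrite /=; field; rewrite gt_eqF.
have e4 : path_value (- t / (1 - t)) 4 = (1 - 2 * t) * (1 - 4 * t) / (1 - t) ^+ 2.
  by rewrite /=; field; rewrite gt_eqF.
have t2 : 0 < 1 - 2 * t by move: p1; rewrite e1 pmulr_lgt0 ?invr_gt0.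
have t4 : 0 < 1 - 4 * t by move: p4; rewrite e4 pmulr_lgt0 ?invr_gt0 ?exprn_gt0 // pmulr_rgt0.
by apply: cycle_value3_pos => //; rewrite -subr_gt0.
Qed.
End Comparison.

Section Bounds.
Local Open Scope ring_scope.
Variable R : realType.
Implicit Types (t : R) (G H : sgraph).

Lemma unicyclic_card G : unicyclic G -> (2 < #|G|)%N.
Proof.
case=> c /andP[c2 /andP[_ uc]] _; apply: leq_trans c2 _.
by rewrite -(card_uniqP uc) max_card.
Qed.

Lemma ieval_cycle_graph N t : (0 < N)%N ->
  ieval [set: cycle_graph N.*2.+1] (- t) = cycle_value t N.
Proof.
case: N => // N _; have [num ->] := cycle_graph_numbering N.*2.
exact: (ieval_cycle _ num).
Qed.

Lemma ieval_hept G (f : nat -> G) t : cycle_numbering f 7 -> [set: G] = [set y in mkseq f 7] ->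
  ieval [set: G] (- t) = cycle_value t 3.
Proof. by move=> num ->; rewrite (ieval_cycle _ num). Qed.

Lemma xi_le_M G : connected G -> well_covered G -> unicyclic G -> odd #|G| ->
  xi G R <= xi (M #|G|) R.
Proof.
move=> conn wc uni oG; have G2 := unicyclic_card uni.
apply: xi_le => [||t /andP[t0 _] pos]; first exact: ltn_trans G2.
  by apply/card_gt0P; exists (inl ord0).
have [[K [N [tK cK cG red]]]|[f num eG]] := well_covered_unicyclic_structure conn wc uni oG.
  apply: (tree_reducible_M_pos tK cK cG _ _ t0 pos); first by lia.
  by move=> x x1; apply: red.
rewrite (ieval_hept _ num eG); apply: cycle_value3_pos => //.
have [t1 t2] := M_pos t0 pos.
have -> : #|G| = 7 by rewrite -cardsT eG cardsE (card_uniqP _) ?size_mkseq //; case: num.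
rewrite (_ : ((7 - 3) %/ 2).+1 = 3) // => hy.
have y1 : t / (1 - t) < 1 by rewrite ltr_pdivrMr ?subr_gt0 //; lra.
(* This is 4 t < 1 in the variable y. For y >= 1/3 the inequality y < (1 - y)^3 from M_7 fails, as
   (2/3)^3 = 8/27 < 1/3. *)
have y3 : t / (1 - t) < 1 / 3.
  rewrite ltNge; apply/negP => y_ge.
  have le3 : (1 - t / (1 - t)) ^+ 3 <= (2 / 3) ^+ 3.
    by apply: lerXn2r; rewrite ?nnegrE; lra.
  have := lt_le_trans hy le3; rewrite !exprS expr0; lra.
by move: y3; rewrite ltr_pdivrMr ?subr_gt0 //; lra.
Qed.

Lemma xi_cycle_graph_le G : connected G -> well_covered G -> unicyclic G -> odd #|G| ->
  (#|G| <= 7)%N -> xi (cycle_graph #|G|) R <= xi G R.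
Proof.
move=> conn wc uni oG G7; have G2 := unicyclic_card uni.
apply: xi_le => [||t tt pos]; [by rewrite card_ord; exact: ltn_trans G2|exact: ltn_trans G2|].
have /andP[t0 _] := tt.
have [[K [N [tK cK cG red]]]|[f num eG]] := well_covered_unicyclic_structure conn wc uni oG.
  have N14 : (0 < N < 4)%N by lia.
  have /set0Pn[v vK] : K != set0 by rewrite -card_gt0 cK.
  have t1 := pos_lt1 v pos.
  rewrite cG ieval_cycle_graph; last by case/andP: N14.
  apply: cycle_value_pos => //.
  by apply: (tree_reducible_path tK cK) => // x x1; apply: red.
have -> : #|G| = 3.*2.+1.
  by rewrite -cardsT eG cardsE (card_uniqP _) ?size_mkseq //; case: num.
by rewrite ieval_cycle_graph // -(ieval_hept _ num eG).
Qed.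

Lemma xi_SP_le G H : connected G -> well_covered G -> unicyclic G -> odd #|G| ->
  (9 <= #|G|)%N -> in_SP H -> #|H| = #|G| -> xi H R <= xi G R.
Proof.
move=> conn wc uni oG G9 [g [k [l [g35 _ iso]]]] cH; have G2 := unicyclic_card uni.
apply: xi_le => [||t tt pos]; [by rewrite cH; exact: ltn_trans G2|exact: ltn_trans G2|].
have /andP[t0 _] := tt.
have [[K [N [tK cK cG red]]]|[f num eG]] := well_covered_unicyclic_structure conn wc uni oG; last first.
  by move: G9; rewrite -cardsT eG cardsE (card_uniqP _) ?size_mkseq //; case: num.
have /set0Pn[v vK] : K != set0 by rewrite -card_gt0 cK.
have t1 := pos_lt1 v pos.
have t1' : 0 < 1 - t by rewrite subr_gt0.
(* H has order 2 N + 1, and for g = 3 as for g = 5 its tree is the path on N + 1 vertices, so one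
   positivity statement serves both. *)
have pN := tree_reducible_path tK cK (red R) tt t1.
rewrite (ieval_iso _ iso).
have cHG := card_Ggkl g k l; rewrite -(card_iso iso) cH cG in cHG.
case: g35 iso cHG => -> iso cHG.
  have eN : N = (k + l).+1 by lia.
  by rewrite ieval_Ggkl3 ?gt_eqF // mulr_gt0 ?exprn_gt0 // pN // eN.
have eN : N = (k + l).+2 by lia.
by rewrite ieval_Ggkl5 ?gt_eqF // mulr_gt0 ?exprn_gt0 // pN // eN.
Qed.

End Bounds.

Theorem corollary3p19 (R : realType) (n : nat) (G : sgraph)
  (G_connected : connected G) (G_well_covered : well_covered G)
  (G_unicyclic : unicyclic G) (G_order : #|G| = n) (n_odd : odd n) :
  (n <= 7 ->
     (xi (cycle_graph n) R <= xi G R)%R /\ (xi G R <= xi (M n) R)%R) /\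
  (9 <= n -> forall H : sgraph, in_SP H -> #|H| = n ->
     (xi H R <= xi G R)%R /\ (xi G R <= xi (M n) R)%R).
Proof.
subst n; have leM := xi_le_M R G_connected G_well_covered G_unicyclic n_odd.
split=> [G7|G9 H HSP cH]; split=> //; [exact: xi_cycle_graph_le|exact: xi_SP_le].
Qed.
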